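(* Let $n\ge 2$ and let $P=(\mathbf p,\mathbf r)$ be a packing of $n$ disks in the Euclidean plane $\mathbb{R}^2$ whose radii $\mathbf r=(r_1,\dots,r_n)$ are generic, or, more generally, whose radii ratios $(r_1/r_n,\dots,r_{n-1}/r_n)$ are generic in $\mathbb{R}^{n-1}$. Then the contact graph $G$ of $P$ has at most $2n-3$ edges and is Laman-sparse and planar. Moreover, if $P$ has exactly $2n-3$ contacts, then $P$ is rigid and infinitesimally rigid; if $P$ has fewer than $2n-3$ contacts, then $P$ is flexible and infinitesimally flexible.
   Context: A vector in $\mathbb{R}^N$ is generic if its coordinates are algebraically independent over $\mathbb{Q}$. A (planar) packing $P=(\mathbf p,\mathbf r)$ of $n$ disks consists of centers $\mathbf p=(\mathbf p_1,\dots,\mathbf p_n)\in(\mathbb{R}^2)^n$ and radii $\mathbf r=(r_1,\dots,r_n)$, $r_i>0$, such that the disks have pairwise disjoint interiors. Its contact graph $G$ has vertex set $\{1,\dots,n\}$ and an edge $ij$ whenever disks $i$ and $j$ are tangent, i.e. $\|\mathbf p_i-\mathbf p_j\|=r_i+r_j$. Contacts of $P$ are the edges of $G$. A flex of $P$ is a continuous motion of the centers, starting at $\mathbf p$ and with the radii held fixed, that preserves disjointness of the disk interiors and preserves tangency for every pair of disks corresponding to an edge of $G$ (sticky disks). $P$ is rigid if all its flexes arise from rigid body motions of the plane, and flexible otherwise. An infinitesimal flex of $P$ is an assignment of a vector $\mathbf p'_i\in\mathbb{R}^2$ to each vertex $i$ such that $(\mathbf p_j-\mathbf p_i)\cdot(\mathbf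 p'_j-\mathbf p'_i)=0$ for all edges $ij$ of $G$. The trivial infinitesimal flexes are those arising from Euclidean isometries of the plane (a $3$-dimensional space). $P$ is infinitesimally rigid if all its infinitesimal flexes are trivial, and infinitesimally flexible otherwise. A graph is Laman-sparse if every subgraph on $n'\ge 2$ vertices with $m'$ edges satisfies $m'\le 2n'-3$. *)

(* Defs.v *)
From HB Require Import structures.
From mathcomp Require Import all_boot all_order all_algebra.
From mathcomp Require Import all_classical all_reals all_analysis.
(* without its notations, which clash with those of mathcomp-analysis *)
From mathcomp.multinomials Require Import(canonicals, coercions) mpoly.

Set Implicit Arguments.
Unset Strict Implicit.
Unset Printing Implicit Defensive.

Import Order.TTheory GRing.Theory Num.Theory.
Import numFieldNormedType.Exports.

Local Open Scope classical_set_scope.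
Local Open Scope ring_scope.

Definition generic (R : realType) (N : nat) (x : 'I_N -> R) : Prop :=
  forall q : mpoly.mpoly N rat, mpoly.mmap (@ratr R) x q = 0 -> q = 0.

Definition last_index (n : nat) (hn : (2 <= n)%N) : 'I_n :=
  Ordinal (etrans (ltn_predL n) (ltnW hn)).

Definition radii_ratios (R : realType) (n : nat) (hn : (2 <= n)%N)
    (r : 'I_n -> R) : 'I_n.-1 -> R :=
  fun i => r (widen_ord (leq_pred n) i) / r (last_index hn).

(* The plane is 'rV[R]_2 with its topology; `|_| is the sup norm there, so the
   Euclidean norm is defined from the dot product. *)
Definition dotp (R : realType) (u v : 'rV[R]_2) : R :=
  \sum_(k < 2) u 0 k * v 0 k.

Definition enorm (R : realType) (u : 'rV[R]_2) : R := Num.sqrt (dotp u u).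

Definition disk (R : realType) (c : 'rV[R]_2) (rho : R) : set 'rV[R]_2 :=
  [set x | enorm (x - c) <= rho].

Definition is_packing (R : realType) (n : nat)
    (p : 'I_n -> 'rV[R]_2) (r : 'I_n -> R) : Prop :=
  (forall i, 0 < r i) /\
  (forall i j, i != j ->
     interior (disk (p i) (r i)) `&` interior (disk (p j) (r j)) = set0).

Definition contact (R : realType) (n : nat)
    (p : 'I_n -> 'rV[R]_2) (r : 'I_n -> R) : rel 'I_n :=
  fun i j => (i != j) && (enorm (p i - p j) == r i + r j).

(* A graph on T is given by its adjacency relation, its edges being the
   two-element sets {i, j} with i adjacent to j. *)
Definition edges (T : finType) (g : rel T) : {set {set T}} :=
  [set e : {set T} | [exists i, exists j,
     [&& i != j, g i j & e == [set i; j]%SET]]]%SET.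

Definition laman_sparse (T : finType) (g : rel T) : Prop :=
  forall (A : {set T}) (F : {set {set T}}),
    F \subset edges g -> (forall e, e \in F -> e \subset A) ->
    (2 <= #|A|)%N -> (#|F| <= 2 * #|A| - 3)%N.

(* Topological planarity: vertices are drawn as distinct points pos i, and each
   edge e as a simple arc (arc e) on [0, 1] joining the positions of its two
   ends, whose relative interior meets neither vertices nor other edges. *)
Definition planar (R : realType) (T : finType) (g : rel T) : Prop :=
  exists (pos : T -> 'rV[R]_2) (arc : {set T} -> R -> 'rV[R]_2),
  [/\ injective pos,
      forall e, e \in edges g ->
        [/\ {within `[0, 1], continuous (arc e)},
            {in `[0, 1] &, injective (arc e)} &
            [set arc e 0; arc e 1] = pos @` [set` e]],
      forall e, e \in edges g ->
        forall t i, t \in `]0, 1[ -> arc e t <> pos i &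
      forall e f, e \in edges g -> f \in edges g -> e != f ->
        forall s t, s \in `]0, 1[ -> t \in `]0, 1[ -> arc e s <> arc f t].

Definition is_flex (R : realType) (n : nat)
    (p : 'I_n -> 'rV[R]_2) (r : 'I_n -> R)
    (q : R -> 'I_n -> 'rV[R]_2) : Prop :=
  [/\ forall i, {within `[0, 1], continuous (fun t => q t i)},
      forall i, q 0 i = p i &
      forall t, t \in `[0, 1] ->
        is_packing (q t) r /\
        (forall i j, contact p r i j -> contact (q t) r i j)].

Definition is_isometry (R : realType) (f : 'rV[R]_2 -> 'rV[R]_2) : Prop :=
  forall x y, enorm (f x - f y) = enorm (x - y).

(* Each g t preserves orientation automatically, by continuity in t. *)
Definition rigid_body_motion (R : realType)
    (g : R -> 'rV[R]_2 -> 'rV[R]_2) : Prop :=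
  [/\ forall t, t \in `[0, 1] -> is_isometry (g t),
      forall x, g 0 x = x &
      forall x, {within `[0, 1], continuous (fun t => g t x)}].

Definition rigid (R : realType) (n : nat)
    (p : 'I_n -> 'rV[R]_2) (r : 'I_n -> R) : Prop :=
  forall q, is_flex p r q ->
    exists2 g, rigid_body_motion g &
      forall t i, t \in `[0, 1] -> q t i = g t (p i).

Definition flexible (R : realType) (n : nat)
    (p : 'I_n -> 'rV[R]_2) (r : 'I_n -> R) : Prop := ~ rigid p r.

Definition inf_flex (R : realType) (n : nat)
    (p : 'I_n -> 'rV[R]_2) (r : 'I_n -> R) (v : 'I_n -> 'rV[R]_2) : Prop :=
  forall i j, contact p r i j -> dotp (p j - p i) (v j - v i) = 0.

(* v is the initial velocity of the points p i under a one-parameter family of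
   isometries of the plane starting at the identity and differentiable at 0. *)
Definition trivial_inf_flex (R : realType) (n : nat)
    (p : 'I_n -> 'rV[R]_2) (v : 'I_n -> 'rV[R]_2) : Prop :=
  exists g : R -> 'rV[R]_2 -> 'rV[R]_2,
  [/\ forall t, is_isometry (g t),
      forall x, g 0 x = x,
      forall x, derivable (fun t => g t x) 0 1 &
      forall i, v i = derive1 (fun t => g t (p i)) 0].

Definition inf_rigid (R : realType) (n : nat)
    (p : 'I_n -> 'rV[R]_2) (r : 'I_n -> R) : Prop :=
  forall v, inf_flex p r v -> trivial_inf_flex p v.

Definition inf_flexible (R : realType) (n : nat)
    (p : 'I_n -> 'rV[R]_2) (r : 'I_n -> R) : Prop := ~ inf_rigid p r.

(* Main.v *)
Require Import Defs.
From HB Require Import structures.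
From mathcomp Require Import all_boot all_order all_algebra.
From mathcomp Require Import all_classical all_reals all_analysis.
From mathcomp Require Import zify ring lra.
From mathcomp.multinomials Require Import(canonicals, coercions) mpoly.

(** Why generic radii force the contact graph to behave like a generic
    framework.

    Everything follows from one fact: the length constraints of the contacts
    are infinitesimally independent, i.e. a self-stress of the contact graph
    (symmetric weights w i j on the contacts with
    sum_j w i j (p i - p j) = 0 at every disk) vanishes.  This is
    [contact_stress_eq0], and its proof has two halves.

    Genericity ([stress_balances_radii]).  Since the radii are algebraically
    independent, there are derivations D of the field generated by the radii and
    the centers with arbitrarily prescribed values D (r i).  Applying D to
    |p i - p j|^2 = (r i + r j)^2 and summing against w, the left sides cancel by
    equilibrium, so the sum of w i j (r i + r j) (D r i + D r j) is 0 for all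
    choices of the D r i; hence sum_j w i j (r i + r j) = 0 at every disk.  If
    only the ratios of the radii are generic, D is prescribed up to a multiple of
    r, and the missing equation comes from sum w i j (r i + r j)^2 =
    sum w i j |p i - p j|^2 = 0.

    Planarity ([planar_stress_eq0]).  The contacts are drawn as segments that
    meet only at common ends ([contacts_meet]).  The weights around a vertex now
    satisfy three linear equations, two for equilibrium and one for the lengths,
    and parametrizing directions by the tangent of the half angle turns them into
    the vanishing of the moments of order 0, 1 and 2 of a signed sequence.  As in
    Descartes' rule, the signs change at least three times in this sequence
    ([moment_sign_changes]), hence at least four times cyclically around the
    vertex.  A simple plane graph cannot have four sign changes around each of
    its vertices (Cauchy).  Instead of counting faces with Euler's formula, a
    horizontal line is swept upwards: the edges it crosses, read from left to
    right, form a list, and passing a vertex replaces a block of the list by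
    another one.  A weight on the gaps of this list never increases
    ([adj_sum_step]), is negative once the first vertex is passed, and must be 0
    at the end, which is absurd.

    Consequences.  With a disk and a direction pinned, contacts and pins are
    independent linear forms on velocities ([pinned_rows_independent]), which
    gives the edge counts.  With 2n - 3 contacts these forms are coordinates:
    infinitesimal rigidity is immediate, and a displacement w that preserves the
    contacts satisfies |w|^2 <= K |w|^4, so it cannot start moving continuously
    from 0 ([tight_rigid]).  With fewer contacts some coordinate of a center can
    be added as a further independent form; solving the quadratic contact
    equations by a contraction, with that coordinate as parameter, gives a motion
    ([pinned_motion]), and a pinned motion by isometries would not move. *)

Set Implicit Arguments.
Unset Strict Implicit.
Unset Printing Implicit Defensive.

Import Order.TTheory GRing.Theory Num.Theory.
Import numFieldNormedType.Exports.

Local Open Scope ring_scope.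

(** * Sign changes along lists *)

Section AdjacentSums.
Variables (T : Type).
Implicit Types (f : T -> T -> int) (s : seq T).

Fixpoint path_sum f x s : int :=
  if s is y :: s' then f x y + path_sum f y s' else 0.

Definition adj_sum f s : int := if s is x :: s' then path_sum f x s' else 0.

Lemma path_sum_cat f x s1 y s2 :
  path_sum f x (s1 ++ y :: s2) =
  path_sum f x s1 + f (last x s1) y + path_sum f y s2.
Proof. by elim: s1 x => [|z s1 IH] x /=; rewrite ?IH; lia. Qed.

Lemma adj_sum_cons_cat f x s1 y s2 :
  adj_sum f ((x :: s1) ++ y :: s2) =
  adj_sum f (x :: s1) + f (last x s1) y + adj_sum f (y :: s2).
Proof. by rewrite /= path_sum_cat. Qed.

Lemma adj_sum_rcons_cat f s1 x y s2 :
  adj_sum f (rcons s1 x ++ y :: s2) =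
  adj_sum f (rcons s1 x) + f x y + adj_sum f (y :: s2).
Proof.
case: s1 => [|z s1]; first by rewrite /=; lia.
by rewrite rcons_cons adj_sum_cons_cat last_rcons.
Qed.

Lemma adj_sum_rev f s : (forall x y, f x y = f y x) ->
  adj_sum f (rev s) = adj_sum f s.
Proof.
move=> fC; elim: s => [|x [|y s] IH] //.
rewrite rev_cons -cats1 rev_cons adj_sum_rcons_cat -rev_cons IH /= (fC y x).
by lia.
Qed.

Variable sg : T -> bool.

Definition change x y : int := ((sg x != sg y) : nat)%:Z.

(** The parity of the number of sign changes is read off the two end signs; this
    is what upgrades three linear sign changes to four cyclic ones. *)
Lemma path_sum_change_parity x s :
  exists k, path_sum change x s = change x (last x s) + 2 * k.
Proof.
elim: s x => [|y s IH] x /=; first by exists 0; rewrite /change eqxx.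
have [k ->] := IH y; rewrite /change.
exists (k + ((sg x != sg y) && (sg y != sg (last y s)) : nat)%:Z).
by case: (sg x) (sg y) (sg (last y s)) => [] [] [] /=; lia.
Qed.

(** The sweep step.  [L1 ++ D ++ L2] lists the edges crossed just below a vertex
    with downward edges [D], [L1 ++ U ++ L2] those crossed just above it, and
    [D ++ rev U] runs around the vertex.  Opening the gaps inside [U] gains all
    their sign changes, closing the gaps inside [D] loses theirs, and only the two
    gaps beside the vertex can change for the worse.  The four cyclic sign changes
    around the vertex pay for them: among three signs at most two of the three
    pairs differ. *)
Lemma adj_sum_step (phi : T -> T -> int) (L1 D U L2 : seq T) :
  (forall x y, - change x y <= phi x y <= change x y) ->
  adj_sum phi D = adj_sum change D ->
  adj_sum phi U = - adj_sum change U ->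
  3 <= adj_sum change (D ++ rev U) ->
  adj_sum phi (L1 ++ U ++ L2) <= adj_sum phi (L1 ++ D ++ L2) /\
  (D = [::] -> adj_sum phi U < 0).
Proof.
move=> phiP phiD phiU.
have chC x y : change x y = change y x by rewrite /change eq_sym.
have revU : adj_sum change (rev U) = adj_sum change U by rewrite adj_sum_rev.
(* The three cases are a local maximum, an ordinary vertex and a local minimum
   of the height; the outer lists contribute through their end next to the vertex. *)
case: D phiD => [|d D] phiD; last first.
  case/lastP: U phiU revU => [|U u] phiU revU.
    rewrite /rev /= cats0 => ge3; split=> //.
    have [k par] := path_sum_change_parity d D.
    have par' : 4 <= path_sum change d D + change d (last d D).
      by move: par ge3; rewrite /change; case: (_ != _) => /=; lia.
    have := phiD; rewrite /= => {}phiD.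
    case/lastP: L1 => [|L1 l]; case: L2 => [|f L2] /=; rewrite ?cats0 ?phiD.
    - by move: par'; rewrite /change; case: (_ != _) => /=; lia.
    - rewrite path_sum_cat phiD.
      have := phiP (last d D) f; move: par'; rewrite /change.
      by do 2!case: (_ != _) => /=; lia.
    - rewrite adj_sum_rcons_cat /= phiD.
      have := phiP l d; move: par'; rewrite /change.
      by do 2!case: (_ != _) => /=; lia.
    - rewrite -[d :: _]/((d :: D) ++ f :: L2) !adj_sum_rcons_cat /= path_sum_cat phiD.
      have := phiP l f; have := phiP l d; have := phiP (last d D) f.
      move: par'; rewrite /change.
      by case: (sg l) (sg f) (sg d) (sg (last d D)) => [] [] [] [] /=; lia.
  rewrite rev_rcons => ge3; split=> //.
  have [k par] := path_sum_change_parity d (D ++ u :: rev U).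
  have {}ge3 : 4 <= path_sum change d (D ++ u :: rev U) +
               change d (last d (D ++ u :: rev U)).
    by move: par ge3; rewrite /change; case: (_ != _) => /=; lia.
  move: ge3; rewrite path_sum_cat last_cat /=.
  move: revU; rewrite rev_rcons /= => ->.
  have := phiD; rewrite /= => {}phiD.
  have -> : last u (rev U) = head u (rcons U u).
    by case: (U) => //= z U'; rewrite rev_cons last_rcons.
  have Ueq : rcons U u = head u (rcons U u) :: behead (rcons U u) by case: (U).
  have lastU : last (head u (rcons U u)) (behead (rcons U u)) = u.
    by have := last_rcons u U u; rewrite {1}Ueq.
  move: phiU; rewrite Ueq; move: lastU.
  move: (head _ _) (behead _) => u1 U' /= lastU phiU ge4.
  have := phiP.
  case/lastP: L1 => [|L1 l]; case: L2 => [|f L2] /=; rewrite ?cats0 => {}phiP.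
  - rewrite phiD phiU; move: ge4; rewrite /change.
    by do 2!case: (_ != _) => /=; lia.
  - rewrite !path_sum_cat lastU phiD phiU.
    have := phiP (last d D) f; have := phiP u f; move: ge4; rewrite /change.
    by case: (sg u) (sg f) (sg d) (sg (last d D)) (sg u1) => [] [] [] [] [] /=; lia.
  - rewrite !adj_sum_rcons_cat /= phiD phiU.
    have := phiP l u1; have := phiP l d; move: ge4; rewrite /change.
    by case: (sg u) (sg l) (sg d) (sg (last d D)) (sg u1) => [] [] [] [] [] /=; lia.
  - rewrite !adj_sum_rcons_cat /= !path_sum_cat lastU phiD phiU.
    have := phiP l u1; have := phiP l d; have := phiP (last d D) f.
    have := phiP u f; move: ge4; rewrite /change.
    by case: (sg u) (sg l) (sg f) (sg d) (sg (last d D)) (sg u1)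
      => [] [] [] [] [] [] /=; lia.
rewrite /= revU; case: U phiU revU => [|u U] //= phiU _ ge3.
split; last by rewrite phiU; lia.
have [k par] := path_sum_change_parity u U.
have ge4 : 4 <= path_sum change u U + change u (last u U).
  by move: par ge3; rewrite /change; case: (_ != _) => /=; lia.
case/lastP: L1 => [|L1 l]; case: L2 => [|f L2] /=; rewrite ?cats0.
- by rewrite phiU; lia.
- rewrite path_sum_cat phiU.
  have := phiP (last u U) f; move: ge4; rewrite /change.
  by do 2!case: (_ != _) => /=; lia.
- rewrite adj_sum_rcons_cat /= phiU.
  have := phiP l u; move: ge4; rewrite /change.
  by do 2!case: (_ != _) => /=; lia.
- rewrite !adj_sum_rcons_cat /= path_sum_cat phiU.
  have := phiP l f; have := phiP l u; have := phiP (last u U) f.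
  move: ge4; rewrite /change.
  by case: (sg u) (sg l) (sg f) (sg (last u U)) => [] [] [] [] /=; lia.
Qed.

End AdjacentSums.

Lemma eq_adj_sum (T : eqType) (f g : T -> T -> int) (s : seq T) :
  {in s &, f =2 g} -> adj_sum f s = adj_sum g s.
Proof.
case: s => // x s; elim: s x => //= y s IH x fg.
rewrite fg ?inE ?eqxx ?orbT // IH // => a b sa sb.
by apply: fg; rewrite inE ?sa ?sb orbT.
Qed.

Lemma adj_sumN (T : Type) (f : T -> T -> int) (s : seq T) :
  adj_sum (fun x y => - f x y) s = - adj_sum f s.
Proof.
by case: s => [|x s] /=; [lia | elim: s x => [|y s IH] x /=; rewrite ?IH; lia].
Qed.

(** * Vanishing moments force sign changes *)

Section Moments.
Variables (R : realFieldType) (T : eqType) (tau m : T -> R).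

Let sgn x := 0 < m x.

(** A polynomial that follows the signs of [m]: one root between each two
    consecutive points with different signs.  The condition to the left of
    [tau x] is what lets the induction add a point there. *)
Lemma sign_change_poly x s :
  path (fun a b => tau a < tau b) x s -> {in x :: s, forall y, m y != 0} ->
  exists q : {poly R},
  [/\ (size q)%:Z <= path_sum (change sgn) x s + 1,
      forall z, z <= tau x -> 0 < m x * q.[z] &
      {in x :: s, forall y, 0 < m y * q.[tau y]}].
Proof.
elim: s x => [|y s IH] x /=.
  move=> _ /(_ x (mem_head _ _)) mx; exists (m x)%:P.
  have mm : 0 < m x * m x by rewrite -expr2 exprn_even_gt0.
  split=> [|z _|y]; rewrite ?hornerC //; first by rewrite size_polyC mx.
  by rewrite inE => /eqP ->.
move=> /andP[xy ys] m0.
have [z zs|q [szq qlow qpos]] := IH y ys; first by apply: m0; rewrite inE zs orbT.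
have mx : m x != 0 by apply: m0; rewrite mem_head.
have my : m y != 0 by apply: m0; rewrite !inE eqxx orbT.
have le_all z : z \in y :: s -> tau y <= tau z.
  rewrite inE => /orP[/eqP -> //|zs]; apply/ltW.
  by move: ys; rewrite path_sortedE; [case/andP=> /allP/(_ _ zs)|move=> ? ? ? /lt_trans; apply].
have [sxy|sxy] := eqVneq (sgn x) (sgn y).
  have sgxy z : 0 < m y * z -> 0 < m x * z.
    have : 0 < m x * m y.
      move: sxy mx my; rewrite /sgn.
      case: (ltgtP 0 (m x)) => // hx; case: (ltgtP 0 (m y)) => // hy _ _ _.
        by rewrite mulr_gt0.
      by rewrite nmulr_lgt0.
    move=> h1 h2; have := mulr_gt0 h1 h2.
    by rewrite mulrACA (mulrC (m y)) mulrACA pmulr_lgt0 // -expr2 exprn_even_gt0.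
  exists q; split=> [|z zx|z].
  - by move: szq; set P := path_sum _ _ _; rewrite /change sxy eqxx /=; lia.
  - by apply: sgxy; apply: qlow; apply: le_trans zx (ltW xy).
  - rewrite inE => /orP[/eqP ->|]; last exact: qpos.
    by apply: sgxy; apply: qlow; apply: ltW.
have sgxy z : 0 < m y * z -> m x * z < 0.
  have : m x * m y < 0.
    move: sxy mx my; rewrite /sgn.
    case: (ltgtP 0 (m x)) => // hx; case: (ltgtP 0 (m y)) => // hy _ _ _.
      by rewrite pmulr_rlt0.
    by rewrite nmulr_rlt0.
  move=> h1 h2; have : m x * m y * (m y * z) < 0 by rewrite nmulr_rlt0.
  by rewrite mulrACA (mulrC (m y)) mulrACA pmulr_llt0 // -expr2 exprn_even_gt0.
(* a new root between the two points restores the sign on the left *)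
pose mid := (tau x + tau y) / 2.
have xm : tau x < mid by rewrite /mid; lra.
have my' : mid < tau y by rewrite /mid; lra.
have low z : z <= tau x -> 0 < m x * (('X - mid%:P) * q).[z].
  move=> zx; rewrite hornerM hornerXsubC mulrCA nmulr_rgt0.
    by apply: sgxy; apply: qlow; apply: le_trans zx (ltW xy).
  by rewrite subr_lt0; apply: le_lt_trans zx xm.
exists (('X - mid%:P) * q); split=> [|//|z].
- have szM : (size (('X - mid%:P) * q)%R <= (size q).+1)%N.
    by apply: leq_trans (size_polyMleq _ _) _; rewrite size_XsubC.
  apply: (@le_trans _ _ (size q).+1%:Z); first by rewrite lez_nat.
  by move: szq; set P := path_sum _ _ _; rewrite /change sxy /=; lia.
- rewrite inE => /orP[/eqP ->|zs]; first exact: low.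
  rewrite hornerM hornerXsubC mulrCA pmulr_rgt0 ?qpos //.
  by rewrite subr_gt0; apply: lt_le_trans my' (le_all _ zs).
Qed.

(** With at most two sign changes, the polynomial of [sign_change_poly] is
    quadratic; pairing it with the moments gives 0 as a sum of positive terms. *)
Lemma moment_sign_changes x s :
  path (fun a b => tau a < tau b) x s -> {in x :: s, forall y, m y != 0} ->
  (forall k, (k < 3)%N -> \sum_(y <- x :: s) m y * tau y ^+ k = 0) ->
  3 <= adj_sum (change sgn) (x :: s).
Proof.
move=> xs m0 mom; rewrite leNgt; apply/negP => lt3.
have [q [szq _ qpos]] := sign_change_poly xs m0.
have {}szq : (size q <= 3)%N by move: szq lt3 => /=; lia.
have : 0 < \sum_(y <- x :: s) m y * q.[tau y].
  rewrite big_cons ltr_pwDl //; first by apply: qpos; rewrite mem_head.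
  rewrite big_seq sumr_ge0 // => y ys; apply/ltW/qpos.
  by rewrite inE ys orbT.
suff -> : \sum_(y <- x :: s) m y * q.[tau y] = 0 by rewrite ltxx.
under eq_bigr => y _ do rewrite (horner_coef_wide _ szq) mulr_sumr.
rewrite exchange_big /= big1 // => k _.
under eq_bigr => y _ do rewrite mulrCA.
by rewrite -mulr_sumr mom // mulr0.
Qed.

End Moments.

(** * Sweeping a plane graph *)

Lemma conv_between (R : realFieldType) (a b x y t : R) : 0 <= t <= 1 ->
  (a <= x <= b -> a <= y <= b -> a <= x + t * (y - x) <= b) /\
  (a < x < b -> a < y < b -> a < x + t * (y - x) < b).
Proof.
case/andP=> t0 t1; split=> /andP[ax xb] /andP[ay yb]; apply/andP; split.
- by nra.
- by nra.
- have [->|t1'] := eqVneq t 1; first by lra.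
  have : 0 < (1 - t) * (x - a) by rewrite mulr_gt0 // subr_gt0 // lt_neqAle t1'.
  by nra.
- have [->|t1'] := eqVneq t 1; first by lra.
  have : 0 < (1 - t) * (b - x) by rewrite mulr_gt0 // subr_gt0 // lt_neqAle t1'.
  by nra.
Qed.

Section Sweep.
Variables (R : realFieldType) (T : finType) (X H : T -> R).
Variables (w l : T -> T -> R).

Hypothesis w_sym : forall i j, w i j = w j i.
Hypothesis H_inj : injective H.
Hypothesis l_gt0 : forall i j, w i j != 0 -> 0 < l i j.
Hypothesis l_sqr : forall i j, w i j != 0 ->
  l i j ^+ 2 = (X j - X i) ^+ 2 + (H j - H i) ^+ 2.
Hypothesis w_X : forall i, \sum_j w i j * (X j - X i) = 0.
Hypothesis w_H : forall i, \sum_j w i j * (H j - H i) = 0.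
Hypothesis w_l : forall i, \sum_j w i j * l i j = 0.
Hypothesis nocross : forall i j k m (s t : R), w i j != 0 -> w k m != 0 ->
  0 <= s <= 1 -> 0 <= t <= 1 ->
  X i + s * (X j - X i) = X k + t * (X m - X k) ->
  H i + s * (H j - H i) = H k + t * (H m - H k) ->
  [\/ (i, j) = (k, m), (i, j) = (m, k)
    | (s = 0 \/ s = 1) /\ (t = 0 \/ t = 1)].

(** An edge is represented once, as the pair of its lower and upper end. *)
Definition up_arc (a : T * T) := (w a.1 a.2 != 0) && (H a.1 < H a.2).

Definition slope (a : T * T) := (X a.2 - X a.1) / (H a.2 - H a.1).

Definition xpos (a : T * T) h := X a.1 + (h - H a.1) * slope a.

Lemma up_arc_lt a : up_arc a -> H a.1 < H a.2. Proof. by case/andP. Qed.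

Lemma xpos_top a h : up_arc a -> xpos a h = X a.2 + (h - H a.2) * slope a.
Proof. by move/up_arc_lt => ha; rewrite /xpos /slope; field; rewrite subr_eq0 gt_eqF. Qed.

Lemma xpos_bot a : xpos a (H a.1) = X a.1.
Proof. by rewrite /xpos subrr mul0r addr0. Qed.

(** Strictness for [b] is what rules out a meeting at a common end. *)
Lemma arcs_meet a b h : up_arc a -> up_arc b ->
  H a.1 <= h <= H a.2 -> H b.1 < h < H b.2 -> xpos a h = xpos b h -> a = b.
Proof.
case: a b => [i j] [k m] /andP[/= wa ha] /andP[/= wb hb] ah bh eab.
have da : 0 < H j - H i by rewrite subr_gt0.
have db : 0 < H m - H k by rewrite subr_gt0.
have := @nocross i j k m ((h - H i) / (H j - H i)) ((h - H k) / (H m - H k)) wa wb.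
case.
- by rewrite divr_ge0 ?ler_pdivrMr //=; [lra | lra | lra].
- by rewrite divr_ge0 ?ler_pdivrMr //=; [lra | lra | lra].
- by move: eab; rewrite /xpos /slope /= ![_ / _ * (X _ - X _)]mulrAC !mulrA.
- by rewrite !divfK ?gt_eqF //; lra.
- by [].
- by case=> ei ej; move: ha hb; rewrite ei ej => /lt_trans h1 /h1; rewrite ltxx.
- case=> _ tb; exfalso; move: tb => [] /eqP.
    by rewrite mulf_eq0 invr_eq0 (gt_eqF db) orbF subr_eq0 => /eqP ?; lra.
  by move/eqP/(congr1 ( *%R^~ (H m - H k))); rewrite divfK ?gt_eqF // mul1r; lra.
Qed.

Definition lth h : rel (T * T) := fun a b => xpos a h < xpos b h.

Lemma xpos_conv a h0 h1 t :
  xpos a (h0 + t * (h1 - h0)) = xpos a h0 + t * (xpos a h1 - xpos a h0).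
Proof. by rewrite /xpos; ring. Qed.

(** Two edges that do not meet keep their left-to-right order, as the difference
    of their positions is affine in the height.  Only [b] is required to be away
    from its ends: this covers an edge [a] starting or ending at height [h0]. *)
Lemma order_kept a b h0 h1 : up_arc a -> up_arc b ->
  H a.1 <= h0 <= H a.2 -> H a.1 <= h1 <= H a.2 ->
  H b.1 < h0 < H b.2 -> H b.1 < h1 < H b.2 ->
  (lth h0 a b -> lth h1 a b) /\ (lth h0 b a -> lth h1 b a).
Proof.
move=> ua ub a0 a1 b0 b1.
have nz t : 0 <= t <= 1 -> xpos a h0 != xpos b h0 ->
    xpos a h0 + t * (xpos a h1 - xpos a h0) !=
    xpos b h0 + t * (xpos b h1 - xpos b h0).
  move=> t01 ne; rewrite -!xpos_conv; apply/eqP => eqx.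
  suff ab : a = b by rewrite ab eqxx in ne.
  apply: (arcs_meet ua ub _ _ eqx).
    by apply: (conv_between _ _ _ _ t01).1.
  by apply: (conv_between _ _ _ _ t01).2.
(* an affine difference that changes sign has a zero in between *)
have key x0 x1 y0 y1 : x0 < y0 -> y1 <= x1 :> R ->
    exists2 t, 0 <= t <= 1 & x0 + t * (x1 - x0) = y0 + t * (y1 - y0).
  move=> lt0 le1; have d : 0 < (y0 - x0) + (x1 - y1) by lra.
  exists ((y0 - x0) / ((y0 - x0) + (x1 - y1))).
    by rewrite divr_ge0 ?ler_pdivrMr //; lra.
  by field; rewrite gt_eqF.
rewrite /lth; split=> lt0; rewrite ltNge; apply/negP => le1.
  have [t t01 /eqP] := key _ _ _ _ lt0 le1; apply/negP/nz => //.
  by rewrite lt_eqF.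
have [t t01 /esym/eqP] := key _ _ _ _ lt0 le1; apply/negP/nz => //.
by rewrite gt_eqF.
Qed.

Definition arcs_at h (P : pred (T * T)) : seq (T * T) :=
  sort (fun a b => xpos a h <= xpos b h) (enum P).

Lemma mem_arcs_at h P : arcs_at h P =i P.
Proof. by move=> a; rewrite mem_sort mem_enum. Qed.

Lemma arcs_at_sorted h (P : pred (T * T)) :
  {in P &, injective (xpos^~ h)} -> pairwise (lth h) (arcs_at h P).
Proof.
move=> inj; rewrite -(@pairwise_map _ _ (xpos^~ h) <%R).
rewrite -sorted_pairwise; last exact: lt_trans.
rewrite lt_sorted_uniq_le map_inj_in_uniq.
  rewrite sort_uniq enum_uniq /= sorted_map.
  by apply: sort_sorted => a b; exact: le_total.
by move=> a b; rewrite !mem_arcs_at; exact: inj.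
Qed.

Lemma pairwise_lth_inj h s1 s2 : pairwise (lth h) s1 -> pairwise (lth h) s2 ->
  s1 =i s2 -> s1 = s2.
Proof.
have tr : transitive (lth h) by move=> b a c; exact: lt_trans.
rewrite -!(sorted_pairwise tr); apply: irr_sorted_eq => // a.
by rewrite /lth ltxx.
Qed.

Definition crossing h : pred (T * T) := fun a => up_arc a && (H a.1 < h < H a.2).

Definition level h := arcs_at h (crossing h).

Definition below v : pred (T * T) := fun a => up_arc a && (a.2 == v).
Definition above v : pred (T * T) := fun a => up_arc a && (a.1 == v).
Definition left_of v : pred (T * T) :=
  fun a => crossing (H v) a && (xpos a (H v) < X v).
Definition right_of v : pred (T * T) :=
  fun a => crossing (H v) a && ~~ (xpos a (H v) < X v).

Lemma crossing_inj h a b : crossing h a -> crossing h b ->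
  xpos a h = xpos b h -> a = b.
Proof.
move=> /andP[ua ah] /andP[ub bh]; apply: arcs_meet => //.
by case/andP: ah => *; rewrite !ltW.
Qed.

Lemma level_sorted h : pairwise (lth h) (level h).
Proof. by apply: arcs_at_sorted => a b; exact: crossing_inj. Qed.

(** Both sides of a vertex at once: [h] is a height just above or just below the
    vertex, and [I] is the set of edges at the vertex on that side.  The edges that
    pass by the vertex contribute the same two outer blocks on both sides. *)
Lemma level_split v h (I : pred (T * T)) :
  (forall a, I a -> [/\ up_arc a, H a.1 <= H v <= H a.2, H a.1 < h < H a.2
     & (a.1 == v) || (a.2 == v)]) ->
  (forall a, crossing (H v) a -> crossing h a) ->
  (forall a, crossing h a -> crossing (H v) a || I a) ->
  level h = arcs_at (H v) (left_of v) ++ arcs_at h I ++ arcs_at (H v) (right_of v).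
Proof.
move=> IP throughP splitP.
have xI a : I a -> xpos a (H v) = X v.
  move/IP => [ua _ _ /orP[] /eqP <-]; first by rewrite xpos_bot.
  by rewrite xpos_top // subrr mul0r addr0.
have Icr a : I a -> crossing h a by move/IP => [ua _ ah _]; rewrite /crossing ua.
have keep a b : crossing (H v) a -> crossing (H v) b ->
    lth (H v) a b -> lth h a b.
  move=> ca cb.
  have /andP[ua av] := ca; have /andP[ub bv] := cb.
  have /andP[_ ah] := throughP _ ca; have /andP[_ bh] := throughP _ cb.
  have le_of (x y z : R) : x < y < z -> x <= y <= z by case/andP=> /ltW -> /ltW ->.
  by have [] := order_kept ua ub (le_of _ _ _ av) (le_of _ _ _ ah) bv bh.
have keepI a b : I a -> crossing (H v) b ->
    (lth (H v) a b -> lth h a b) /\ (lth (H v) b a -> lth h b a).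
  move=> /IP[ua av ah _] cb; have /andP[ub bv] := cb.
  have /andP[_ bh] := throughP _ cb.
  apply: order_kept => //; by case/andP: ah => /ltW -> /ltW ->.
apply: (@pairwise_lth_inj h); first exact: level_sorted; last first.
  move=> a; rewrite !mem_cat !mem_arcs_at /in_mem /= /left_of /right_of.
  apply/idP/idP => [/splitP/orP[ca|->]|]; rewrite ?orbT //.
    by rewrite ca /=; case: (_ < _); rewrite /= ?orbT.
  by case/or3P => [/andP[/throughP]|/Icr|/andP[/throughP]].
have through_inj a b : crossing (H v) a -> crossing (H v) b ->
  xpos a (H v) = xpos b (H v) -> a = b by exact: crossing_inj.
rewrite !pairwise_cat; apply/and5P; split.
- rewrite allrel_catr; apply/andP; split; apply/allrelP => a b;
    rewrite !mem_arcs_at /in_mem /= => /andP[ca la].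
  + move=> Ib; have [_] := keepI b a Ib ca; apply.
    by rewrite /lth (xI _ Ib).
  + case/andP => cb; rewrite -leNgt => lb; apply: keep => //.
    exact: lt_le_trans la lb.
- have /sub_in_pairwise : {in left_of v &, forall a b, lth (H v) a b -> lth h a b}.
    by move=> a b /andP[ca _] /andP[cb _]; exact: keep.
  apply; first by apply/allP => a; rewrite mem_arcs_at.
  by apply: arcs_at_sorted => a b /andP[ca _] /andP[cb _]; exact: through_inj.
- apply/allrelP => a b; rewrite !mem_arcs_at /in_mem /= => Ia /andP[cb].
  rewrite -leNgt => lb; have [+ _] := keepI a b Ia cb; apply.
  have [ua av _ inc] := IP _ Ia; have xa := xI _ Ia.
  rewrite /lth lt_neqAle xa lb andbT -xa; apply/eqP => eqx.
  have /andP[ub bv] := cb.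
  have ab := arcs_meet ua ub av bv eqx.
  by move: inc bv; rewrite -ab => /orP[] /eqP <-; rewrite ltxx ?andbF.
- by apply: arcs_at_sorted => a b /Icr ca /Icr cb; exact: crossing_inj.
- have /sub_in_pairwise : {in right_of v &, forall a b, lth (H v) a b -> lth h a b}.
    by move=> a b /andP[ca _] /andP[cb _]; exact: keep.
  apply; first by apply/allP => a; rewrite mem_arcs_at.
  by apply: arcs_at_sorted => a b /andP[ca _] /andP[cb _]; exact: through_inj.
Qed.

Definition far_end (v : T) (a : T * T) := if a.1 == v then a.2 else a.1.

(** The tangent of half the angle of the edge, sin / (1 + cos). *)
Definition half_tan v (a : T * T) :=
  (H (far_end v a) - H v) / (l v (far_end v a) + (X (far_end v a) - X v)).

(** The weight w, rescaled by a positive factor for which equilibrium and the length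
    condition become the vanishing of the moments of order 0, 1 and 2 in
    [half_tan]. *)
Definition moment v (a : T * T) :=
  w v (far_end v a) * (l v (far_end v a) + (X (far_end v a) - X v)).

Lemma below_far_end v a : below v a ->
  [/\ far_end v a = a.1, a.2 = v, w v a.1 != 0 & H a.1 < H v].
Proof.
case: a => i j /andP[/andP[/= wa ha] /eqP jv]; rewrite -jv w_sym /far_end /=.
by split=> //; case: eqP => // e; rewrite e jv ltxx in ha.
Qed.

Lemma above_far_end v a : above v a ->
  [/\ far_end v a = a.2, a.1 = v, w v a.2 != 0 & H v < H a.2].
Proof.
by case: a => i j /andP[/andP[/= wa ha] /eqP iv]; rewrite -iv /far_end /= eqxx.
Qed.

Lemma half_tan_den v j : w v j != 0 -> H j != H v -> 0 < l v j + (X j - X v).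
Proof.
move=> wj hj; have l0 := l_gt0 wj; have l2 := l_sqr wj.
have : 0 < (H j - H v) ^+ 2 by rewrite exprn_even_gt0 //= subr_eq0.
by move=> h2; rewrite ltNge; apply/negP => le0; nra.
Qed.

(** The half-angle tangent decreases when the cotangent of the angle increases:
    y = k2 (l1 + d1) and its analogue are the positive roots of
    y (y - 2 P) = (k1 k2)^2 for P = d1 k2 and P = d2 k1. *)
Lemma cot_anti (d1 k1 l1 d2 k2 l2 : R) : 0 < k1 -> 0 < k2 ->
  0 < l1 + d1 -> 0 < l2 + d2 ->
  l1 ^+ 2 = d1 ^+ 2 + k1 ^+ 2 -> l2 ^+ 2 = d2 ^+ 2 + k2 ^+ 2 ->
  d1 / k1 < d2 / k2 -> k2 / (l2 + d2) < k1 / (l1 + d1).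
Proof.
move=> k10 k20 p1 p2 e1 e2; rewrite ltr_pdivrMr // mulrAC ltr_pdivlMr // => lt12.
rewrite ltr_pdivrMr // mulrAC ltr_pdivlMr //.
have y1 : (k2 * (l1 + d1)) * (k2 * (l1 + d1) - 2 * (d1 * k2)) = (k1 * k2) ^+ 2.
  by transitivity (k2 ^+ 2 * (l1 ^+ 2 - d1 ^+ 2)); [ring | rewrite e1; ring].
have y2 : (k1 * (l2 + d2)) * (k1 * (l2 + d2) - 2 * (d2 * k1)) = (k1 * k2) ^+ 2.
  by transitivity (k1 ^+ 2 * (l2 ^+ 2 - d2 ^+ 2)); [ring | rewrite e2; ring].
have : 0 < k2 * (l1 + d1) by rewrite mulr_gt0.
have : 0 < k1 * (l2 + d2) by rewrite mulr_gt0.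
have : 0 < (k1 * k2) ^+ 2 by rewrite exprn_gt0 // mulr_gt0.
move: y1 y2 lt12.
set y1 := k2 * (l1 + d1); set y2 := k1 * (l2 + d2).
set P := d1 * k2; set Q := d2 * k1; set K := (k1 * k2) ^+ 2.
move=> e1' e2' PQ K0 y20 y10; rewrite ltNge; apply/negP => le.
have c2 : 0 < y2 - 2 * Q by rewrite -(pmulr_rgt0 _ y20) e2'.
have lt : y2 - 2 * Q < y1 - 2 * P by lra.
suff : y2 * (y2 - 2 * Q) < y1 * (y1 - 2 * P) by rewrite e1' e2' ltxx.
apply: le_lt_trans (_ : y1 * (y2 - 2 * Q) < _); first by rewrite ler_pM2r.
by rewrite ltr_pM2l.
Qed.

Lemma half_tan_above v a b h : above v a -> above v b -> H v < h -> lth h a b ->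
  half_tan v b < half_tan v a.
Proof.
move=> /above_far_end[oa ea wa ha] /above_far_end[ob eb wb hb] hv.
rewrite /lth /xpos /slope /half_tan oa ob ea eb ltrD2l ltr_pM2l ?subr_gt0 //.
have da := half_tan_den wa (negbT (gt_eqF ha)).
have db := half_tan_den wb (negbT (gt_eqF hb)).
by move=> lt; apply: cot_anti; rewrite ?subr_gt0 //; exact: l_sqr.
Qed.

Lemma half_tan_below v a b h : below v a -> below v b -> h < H v -> lth h a b ->
  half_tan v a < half_tan v b.
Proof.
move=> Da Db hv; have ua := andP Da; have ub := andP Db.
rewrite /lth !xpos_top; try by case: ua ub => ? _ [].
move: Da Db => /below_far_end[oa ea wa ha] /below_far_end[ob eb wb hb].
rewrite /slope /half_tan oa ob ea eb ltrD2l ltr_nM2l ?subr_lt0 //.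
have da := half_tan_den wa (negbT (lt_eqF ha)).
have db := half_tan_den wb (negbT (lt_eqF hb)).
have flip (x y z : R) : (x - y) / z = - ((y - x) / z) by rewrite -mulNr opprB.
rewrite !(flip (X v)) !(flip (H _) (H v)) !ltrN2 => lt.
apply: cot_anti; rewrite ?subr_gt0 //.
- by rewrite l_sqr // -(opprB (H v)) sqrrN.
- by rewrite l_sqr // -(opprB (H v)) sqrrN.
Qed.

Definition positive_arc (a : T * T) := 0 < w a.1 a.2.

(** The identity tau^2 (l + dx) = l - dx is Pythagoras. *)
Lemma w_half_tan v j k : w v j != 0 -> H j != H v -> (k < 3)%N ->
  w v j * (l v j + (X j - X v)) *
    ((H j - H v) / (l v j + (X j - X v))) ^+ k =
  w v j * [:: l v j + (X j - X v); H j - H v; l v j - (X j - X v)]`_k.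
Proof.
move=> wj hj; have d0 := half_tan_den wj hj.
case: k => [|[|[|k]]] //= _; first by rewrite expr0 mulr1.
  by rewrite expr1; field; rewrite gt_eqF.
have e : (H j - H v) ^+ 2 = (l v j + (X j - X v)) * (l v j - (X j - X v)).
  by rewrite mulrC -subr_sqr l_sqr //; ring.
by rewrite expr_div_n e; field; rewrite gt_eqF.
Qed.

(** Downward edges from left to right, then upward edges from right to left, have
    increasing half-angle tangents, so that [moment_sign_changes] applies. *)
Lemma vertex_sign_changes v h0 h1 : h0 < H v < h1 ->
  (exists j, w v j != 0) ->
  (forall a, below v a -> crossing h0 a) ->
  (forall a, above v a -> crossing h1 a) ->
  3 <= adj_sum (change positive_arc)
         (arcs_at h0 (below v) ++ rev (arcs_at h1 (above v))).
Proof.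
case/andP=> h0v vh1 [j wj] crD crU.
set W := _ ++ _.
have Hne i : w v i != 0 -> H i != H v.
  move=> wi; apply/eqP => /H_inj iv; have := l_sqr wi; have := l_gt0 wi.
  by rewrite iv !subrr expr0n addr0 => l0 /eqP; rewrite sqrf_eq0 gt_eqF.
have memW a : (a \in W) = below v a || above v a.
  by rewrite mem_cat mem_rev !mem_arcs_at.
have oW a : a \in W -> w v (far_end v a) != 0.
  by rewrite memW => /orP[/below_far_end[-> _]|/above_far_end[-> _]].
have sD : pairwise (lth h0) (arcs_at h0 (below v)).
  by apply: arcs_at_sorted => a b /crD ca /crD cb; exact: crossing_inj.
have sU : pairwise (lth h1) (arcs_at h1 (above v)).
  by apply: arcs_at_sorted => a b /crU ca /crU cb; exact: crossing_inj.
have tau_sorted : pairwise (fun a b => half_tan v a < half_tan v b) W.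
  rewrite pairwise_cat; apply/and3P; split.
  - apply/allrelP => a b; rewrite mem_rev !mem_arcs_at /in_mem /=.
    move=> /below_far_end[oa _ wa ha] /above_far_end[ob _ wb hb].
    apply: (@lt_trans _ _ 0); rewrite /half_tan ?oa ?ob.
      by rewrite pmulr_llt0 ?subr_lt0 // invr_gt0 half_tan_den // lt_eqF.
    by rewrite divr_gt0 ?subr_gt0 // half_tan_den // gt_eqF.
  - apply: (sub_in_pairwise (P := below v) _ _ sD).
      by move=> a b Da Db; exact: half_tan_below.
    by apply/allP => a; rewrite mem_arcs_at.
  - rewrite -sorted_pairwise => [|? ? ?]; last exact: lt_trans.
    rewrite rev_sorted sorted_pairwise => [|? ? ? lt1 lt2]; last exact: lt_trans lt2 lt1.
    apply: (sub_in_pairwise (P := above v) _ _ sU).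
      by move=> a b Da Db; exact: half_tan_above.
    by apply/allP => a; rewrite mem_arcs_at.
have pW : perm_eq (map (far_end v) W) (enum [pred i | w v i != 0]).
  apply: uniq_perm; [|exact: enum_uniq|].
    rewrite map_inj_in_uniq; last first.
      move=> [a1 a2] [b1 b2]; rewrite !memW.
      case/orP=> [/below_far_end|/above_far_end] [-> /= -> _ ha];
      case/orP=> [/below_far_end|/above_far_end] [-> /= -> _ hb] e.
      - by rewrite e.
      - by move: ha; rewrite e => /lt_trans /(_ hb); rewrite ltxx.
      - by move: ha; rewrite e => /lt_trans /(_ hb); rewrite ltxx.
      - by rewrite e.
    rewrite cat_uniq rev_uniq !sort_uniq !enum_uniq andbT /=.
    apply/hasPn => a; rewrite mem_rev !mem_arcs_at /in_mem /=.
    move=> /above_far_end[_ e _ ha]; apply/negP => /below_far_end[_ _ _].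
    by rewrite e ltxx.
  move=> i; rewrite mem_enum inE; apply/mapP/idP => [[a aW ->]|wi].
    exact: oW.
  have := Hne _ wi; case: (ltgtP (H i) (H v)) => // hi _.
    exists (i, v); last by rewrite /far_end /=; case: eqP => // <-.
    by rewrite memW /below /up_arc /= w_sym wi hi eqxx.
  exists (v, i); last by rewrite /far_end /= eqxx.
  by rewrite memW /above /up_arc /= wi hi eqxx orbT.
have -> : adj_sum (change positive_arc) W =
          adj_sum (change (fun a => 0 < moment v a)) W.
  have sgW a : a \in W -> positive_arc a = (0 < moment v a).
    move=> aW; have wo := oW _ aW; rewrite /moment.
    rewrite pmulr_lgt0 ?half_tan_den ?Hne // /positive_arc.
    move: aW; rewrite memW => /orP[/below_far_end|/above_far_end] [-> -> //].
    by rewrite w_sym.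
  by apply: eq_adj_sum => a b aW bW; rewrite /change !sgW.
case EW : W => [|a s].
  by have := perm_mem pW j; rewrite EW mem_enum [in RHS]inE wj.
apply: (@moment_sign_changes _ _ (half_tan v)).
- move: tau_sorted; rewrite EW -sorted_pairwise //.
  by move=> ? ? ?; exact: lt_trans.
- move=> b; rewrite -EW => bW; have wo := oW _ bW.
  by rewrite /moment mulf_neq0 // gt_eqF // half_tan_den ?Hne.
- move=> k k3; rewrite -EW.
  pose F i := w v i *
    [:: l v i + (X i - X v); H i - H v; l v i - (X i - X v)]`_k.
  transitivity (\sum_(b <- W) F (far_end v b)).
    rewrite big_seq [RHS]big_seq; apply: eq_bigr => b bW.
    by have wo := oW _ bW; rewrite /moment w_half_tan ?Hne.
  rewrite -(big_map (far_end v) xpredT F) (perm_big _ pW) /= big_enum /=.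
  have -> : \sum_(i in [pred i | w v i != 0]) F i = \sum_i F i.
    rewrite [RHS](bigID (fun i => w v i != 0)) /= [X in _ + X]big1 ?addr0 //.
    by move=> i; rewrite negbK /F => /eqP ->; rewrite mul0r.
  rewrite /F; case: k k3 {F} => [|[|[|k]]] //= _.
  - under eq_bigr do rewrite mulrDr.
    by rewrite big_split /= w_l w_X addr0.
  - under eq_bigr do rewrite mulrBr.
    by rewrite sumrB w_l w_X subr0.
Qed.

(** A gap between two edges issued from the same vertex is still an open wedge: it
    cannot be closed at once because the graph is simple, so its sign change counts
    as a credit.  Any other gap counts its sign change as a debt. *)
Definition gap_weight (a b : T * T) : int :=
  if a.1 == b.1 then - change positive_arc a b else change positive_arc a b.

(** Two consecutive edges of [below v] end at the same vertex, so they start at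
    different ones and have nonnegative weight; those of [above v] start at the
    same one.  These are the two evaluations of [gap_weight] that [adj_sum_step]
    asks for. *)
Lemma level_step v h0 h1 : h0 < H v < h1 ->
  (forall i, h0 <= H i <= h1 -> i = v) ->
  [/\ (exists j, w v j != 0) -> adj_sum gap_weight (level h1) <= adj_sum gap_weight (level h0),
      (forall j, w v j = 0) -> adj_sum gap_weight (level h1) = adj_sum gap_weight (level h0) &
      (exists j, w v j != 0) -> level h0 = [::] -> adj_sum gap_weight (level h1) < 0].
Proof.
move=> /[dup] hv /andP[h0v vh1] only.
have lo i : H i < H v -> H i < h0.
  move=> iv; rewrite ltNge; apply/negP => hi.
  by move: (iv); rewrite (only i) ?ltxx // hi ltW // (lt_trans iv).
have hi i : H v < H i -> h1 < H i.
  move=> iv; rewrite ltNge; apply/negP => hi.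
  by move: (iv); rewrite (only i) ?ltxx // hi andbT ltW // (lt_trans _ iv).
have crD a : below v a -> crossing h0 a.
  move=> Da; have /andP[ua _] := Da; have [_ e _ ha] := below_far_end Da.
  by rewrite /crossing ua e h0v andbT /= lo.
have crU a : above v a -> crossing h1 a.
  move=> Ua; have /andP[ua _] := Ua; have [_ e _ ha] := above_far_end Ua.
  by rewrite /crossing ua e vh1 /= hi.
have thr0 a : crossing (H v) a -> crossing h0 a.
  by case/andP=> ua /andP[a1 a2]; rewrite /crossing ua lo //= (lt_trans h0v).
have thr1 a : crossing (H v) a -> crossing h1 a.
  by case/andP=> ua /andP[a1 a2]; rewrite /crossing ua hi //= andbT (lt_trans a1).
have spl0 a : crossing h0 a -> crossing (H v) a || below v a.
  case/andP=> ua /andP[a1 a2]; rewrite /crossing /below ua /= (lt_trans a1) //=.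
  case: (ltgtP (H v) (H a.2)) => //= [/lo|/H_inj ->]; last by rewrite eqxx.
  by move/lt_trans/(_ a2); rewrite ltxx.
have spl1 a : crossing h1 a -> crossing (H v) a || above v a.
  case/andP=> ua /andP[a1 a2]; rewrite /crossing /above ua /= (lt_trans _ a2) //= andbT.
  case: (ltgtP (H a.1) (H v)) => //= [/hi|/H_inj ->]; last by rewrite eqxx.
  by move/lt_trans/(_ a1); rewrite ltxx.
have -> : level h0 = arcs_at (H v) (left_of v) ++ arcs_at h0 (below v)
                       ++ arcs_at (H v) (right_of v).
  apply: level_split => // a Da; have /andP[_ ca] := crD _ Da.
  have /andP[ua /eqP e] := Da; split=> //; last by rewrite e eqxx orbT.
  by rewrite e lexx andbT -e ltW // up_arc_lt.
have -> : level h1 = arcs_at (H v) (left_of v) ++ arcs_at h1 (above v)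
                       ++ arcs_at (H v) (right_of v).
  apply: level_split => // a Ua; have /andP[_ ca] := crU _ Ua.
  have /andP[ua /eqP e] := Ua; split=> //; last by rewrite e eqxx.
  by rewrite e lexx /= -e ltW // up_arc_lt.
have gap_weightP x y : - change positive_arc x y <= gap_weight x y <= change positive_arc x y.
  by rewrite /gap_weight /change; case: ifP; lia.
have phiD : adj_sum gap_weight (arcs_at h0 (below v)) =
            adj_sum (change positive_arc) (arcs_at h0 (below v)).
  apply: eq_adj_sum => a b; rewrite !mem_arcs_at /in_mem /=.
  move=> /below_far_end[_ a2 _ _] /below_far_end[_ b2 _ _].
  rewrite /gap_weight; case: eqP => // ab; have -> : a = b.
    by case: a b a2 b2 ab => [? ?] [? ?] /= -> -> ->.
  by rewrite /change eqxx oppr0.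
have phiU : adj_sum gap_weight (arcs_at h1 (above v)) =
            - adj_sum (change positive_arc) (arcs_at h1 (above v)).
  rewrite -adj_sumN; apply: eq_adj_sum => a b; rewrite !mem_arcs_at /in_mem /=.
  move=> /above_far_end[_ a1 _ _] /above_far_end[_ b1 _ _].
  by rewrite /gap_weight a1 b1 eqxx.
have step (wv : exists j, w v j != 0) :=
  adj_sum_step (arcs_at (H v) (left_of v)) (arcs_at (H v) (right_of v))
    gap_weightP phiD phiU (vertex_sign_changes hv wv crD crU).
split=> [/step[]//|w0|wv].
  have nil h (P : pred (T * T)) : (forall a, P a -> False) -> arcs_at h P = [::].
    move=> P0; case E : (arcs_at h P) => [//|a s].
    by have := mem_head a s; rewrite -E mem_arcs_at => /P0.
  rewrite (nil h0) ?(nil h1) // => a.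
    by move/above_far_end => [_ _ /eqP + _]; apply.
  by move/below_far_end => [_ _ /eqP + _]; apply.
have [_ neg] := step wv.
case: (arcs_at _ (left_of v)) => //=; case: (arcs_at _ (below v)) neg => //=.
by move=> neg; case: (arcs_at _ (right_of v)) => //= _; rewrite cats0 neg.
Qed.

Lemma no_crossing_above h : (forall i, H i < h) -> level h = [::].
Proof.
move=> Hh; case E : (level h) => [//|a s].
have := mem_head a s; rewrite -E mem_arcs_at => /andP[_ /andP[_]].
by rewrite ltNge (ltW (Hh _)).
Qed.

Lemma no_crossing_below h : (forall i, h < H i) -> level h = [::].
Proof.
move=> Hh; case E : (level h) => [//|a s].
have := mem_head a s; rewrite -E mem_arcs_at => /andP[_ /andP[+ _]].
by rewrite ltNge (ltW (Hh _)).
Qed.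

(** Induction on the number of vertices below the height.  The weight becomes
    negative at the lowest vertex with an edge, where all gaps are wedges and have
    at least three sign changes, and it never increases afterwards. *)
Lemma level_nonpos h : (forall i, H i != h) ->
  adj_sum gap_weight (level h) <= 0 /\
  ((exists i j, H i < h /\ w i j != 0) -> adj_sum gap_weight (level h) < 0).
Proof.
have [k] := ubnP #|[pred i | H i < h]|; elim: k h => // k IH h lek hne.
have [i0 /= i0h|none] := pickP [pred i | H i < h]; last first.
  rewrite no_crossing_below /=; last first.
    by move=> i; have := none i; have := hne i; rewrite /=; case: ltgtP.
  by split=> // -[i [j [ih _]]]; have := none i; rewrite /= ih.
have [v vh vmax] := @arg_maxP _ _ _ i0 (fun i => H i < h) H i0h.
have [h0 h0v h0min] : exists2 h0, h0 < H v & forall i, H i < H v -> H i < h0.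
  have [i1 /= i1v|none] := pickP [pred i | H i < H v]; last first.
    by exists (H v - 1) => [|i iv]; [lra | have := none i; rewrite /= iv].
  have [u uv umax] := @arg_maxP _ _ _ i1 (fun i => H i < H v) H i1v.
  have {}uv : H u < H v := uv.
  exists ((H u + H v) / 2) => [|i iv]; first by lra.
  by have iu : H i <= H u := umax _ iv; lra.
have only i : h0 <= H i <= h -> i = v.
  case/andP=> a b; apply: H_inj; apply/le_anti/andP; split.
    by apply: vmax; rewrite lt_neqAle hne.
  by rewrite leNgt; apply/negP => /h0min; rewrite ltNge a.
have hv : h0 < H v < h by rewrite h0v.
have [stepP step0 stepN] := level_step hv only.
have [||le0 lt0] := IH h0.
- rewrite -ltnS; apply: leq_trans lek; rewrite ltnS; apply: proper_card.
  apply/properP; split.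
    by apply/fintype.subsetP => i; rewrite !inE => /lt_trans -> //; exact: lt_trans vh.
  by exists v; rewrite !inE // -leNgt ltW.
- move=> i; apply/eqP => e; have := only i; rewrite e lexx (ltW (lt_trans h0v vh)).
  by move=> /(_ isT) iv; rewrite -e iv ltxx in h0v.
have [wv|wv] := boolP [exists j, w v j != 0].
  have {}wv : exists j, w v j != 0 by apply/existsP.
  split; first exact: le_trans (stepP wv) le0.
  move=> _.
  have [E|] := boolP [exists i, exists j, (H i < h0) && (w i j != 0)].
    apply: le_lt_trans (stepP wv) (lt0 _).
    by case/existsP: E => i /existsP[j /andP[? ?]]; exists i, j.
  rewrite negb_exists => /forallP none; apply: stepN => //.
  case E : (level h0) => [//|a s].
  have := mem_head a s; rewrite -E mem_arcs_at => /andP[/andP[wa _] /andP[ah _]].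
  by have := none a.1; rewrite negb_exists => /forallP/(_ a.2); rewrite ah wa.
rewrite negb_exists in wv; have {}wv j : w v j = 0.
  by apply/eqP; have := forallP wv j; rewrite negbK.
rewrite step0 //; split=> // -[i [j [ih wij]]]; apply: lt0; exists i, j.
have ihv : H i <= H v := vmax _ ih.
split=> //; apply: h0min; rewrite lt_neqAle ihv andbT.
by apply: contraNneq wij => /H_inj ->; rewrite wv.
Qed.

(** Above all vertices the sweep line crosses nothing and the weight is 0, not
    negative: there was no vertex with an edge. *)
Lemma planar_stress_eq0 i j : w i j = 0.
Proof.
apply/eqP/negPn/negP => wij.
pose h := 1 + \sum_k `|H k|.
have Hh k : H k < h.
  rewrite /h (bigD1 k) //=; have := ler_norm (H k).
  have : 0 <= \sum_(i0 | i0 != k) `|H i0| by exact: sumr_ge0.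
  by lra.
have [|_] := @level_nonpos h; first by move=> k; rewrite lt_eqF.
by rewrite no_crossing_above // ltxx => neg; have : false by apply: neg; exists i, j.
Qed.

End Sweep.

(** * Extending derivations *)

Section PartialDerivations.
Variable R : numFieldType.
Implicit Types (S : R -> Prop) (D : R -> R) (f g : {poly R}).

(** A derivation with values in R, defined on a subring only.  The subring is a
    predicate so that it can be enlarged by one element at a time. *)
Definition partial_derivation S D :=
  [/\ S 1, forall x y, S x -> S y -> S (x - y),
      forall x y, S x -> S y -> S (x * y),
      forall x y, S x -> S y -> D (x - y) = D x - D y &
      forall x y, S x -> S y -> D (x * y) = x * D y + y * D x].

Section Adjoin.
Variables (S : R -> Prop) (D : R -> R) (SD : partial_derivation S D) (y : R).

Let S1 : S 1. Proof. by case: SD. Qed.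
Let SB u v : S u -> S v -> S (u - v). Proof. by case: SD => _ + _ _ _; apply. Qed.
Let SM u v : S u -> S v -> S (u * v). Proof. by case: SD => _ _ + _ _; apply. Qed.
Let S0 : S 0. Proof. by rewrite -(subrr 1); apply: SB. Qed.
Let SN u : S u -> S (- u). Proof. by move=> su; rewrite -sub0r; apply: SB. Qed.
Let SDD u v : S u -> S v -> S (u + v).
Proof. by move=> su sv; rewrite -[v]opprK; apply/SB/SN. Qed.
Let DB u v : S u -> S v -> D (u - v) = D u - D v.
Proof. by case: SD => _ _ _ + _; apply. Qed.
Let DM u v : S u -> S v -> D (u * v) = u * D v + v * D u.
Proof. by case: SD => _ _ _ _; apply. Qed.
Let D0 : D 0 = 0. Proof. by have := DB S0 S0; rewrite !subrr. Qed.
Let D1 : D 1 = 0.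
Proof. by apply: (addrI (D 1)); rewrite addr0 -{3}[1]mulr1 DM // !mul1r. Qed.
Let DD u v : S u -> S v -> D (u + v) = D u + D v.
Proof.
move=> su sv; rewrite -{1}[v]opprK DB //; last exact: SN.
by rewrite -[- v]sub0r DB // D0 sub0r opprK.
Qed.

Let S_sum (I : Type) (r : seq I) (F : I -> R) :
  (forall i, S (F i)) -> S (\sum_(i <- r) F i).
Proof. by move=> SF; elim/big_rec: _ => // i x _ Sx; apply: SDD. Qed.

Let D_sum (I : Type) (r : seq I) (F : I -> R) :
  (forall i, S (F i)) -> D (\sum_(i <- r) F i) = \sum_(i <- r) D (F i).
Proof.
move=> SF; elim: r => [|i r IH]; first by rewrite !big_nil.
by rewrite !big_cons DD // ?IH //; apply: S_sum.
Qed.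

Let over_S f := forall i, S f`_i.

Let over_C u : S u -> over_S u%:P.
Proof. by move=> su i; rewrite coefC; case: eqP. Qed.
Let over_X : over_S 'X.
Proof. by move=> i; rewrite coefX; case: eqP. Qed.
Let over_B f g : over_S f -> over_S g -> over_S (f - g).
Proof. by move=> sf sg i; rewrite coefB; apply: SB. Qed.
Let over_M f g : over_S f -> over_S g -> over_S (f * g).
Proof. by move=> sf sg i; rewrite coefM; apply: S_sum => j; apply: SM. Qed.
Let over_Xn k : over_S 'X^k.
Proof. by move=> i; rewrite coefXn; case: eqP. Qed.

(** The value at f.[y] of the extension of [D] that takes the value [e] at [y]. *)
Let extend (e : R) f := (map_poly D f).[y] + e * f^`().[y].

Let coef_D f i : (map_poly D f)`_i = D f`_i. Proof. exact: coef_map_id0. Qed.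

Let extendB e f g : over_S f -> over_S g -> extend e (f - g) = extend e f - extend e g.
Proof.
move=> sf sg; rewrite /extend derivB.
have -> : map_poly D (f - g) = map_poly D f - map_poly D g.
  by apply/polyP => i; rewrite coefB !coef_D coefB DB.
by rewrite !hornerE; ring.
Qed.

Let extendM e f g : over_S f -> over_S g ->
  extend e (f * g) = f.[y] * extend e g + g.[y] * extend e f.
Proof.
move=> sf sg; rewrite /extend derivM.
have -> : map_poly D (f * g) = f * map_poly D g + map_poly D f * g.
  apply/polyP => i; rewrite coefD coef_D !coefM D_sum; last first.
    by move=> j; apply: SM.
  rewrite -big_split /=; apply: eq_bigr => j _.
  by rewrite !coef_D DM // [X in _ + X]mulrC.
by rewrite !hornerE; ring.
Qed.

(** If [y] is transcendental over [S], any value will do.  Otherwise a relation [g]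
    of minimal degree determines the value, since g' does not vanish at [y] in
    characteristic 0; every other relation [f] is consistent with it because
    lead_coef g * f - lead_coef f * 'X^k * g is a relation of smaller degree. *)
Let extension_value : exists e, forall f, over_S f -> f.[y] = 0 -> extend e f = 0.
Proof.
have [[g0 [sg0 g0y g0N0]]|alg] :=
  pselect (exists g, [/\ over_S g, g.[y] = 0 & g != 0]); last first.
  exists 0 => f sf fy; suff -> : f = 0.
    by rewrite /extend map_poly0 deriv0 horner0 mulr0 addr0.
  by apply/eqP/negPn/negP => f0; apply: alg; exists f.
pose P k := `[< exists g, [/\ over_S g, g.[y] = 0, g != 0 & size g = k] >].
have exP : exists k, P k by exists (size g0); apply/asboolP; exists g0.
have [k /asboolP [g [sg gy gN0 szg]] kmin] := ex_minnP exP.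
have small f : over_S f -> f.[y] = 0 -> (size f < size g)%N -> f = 0.
  move=> sf fy lt; apply/eqP/negPn/negP => f0.
  have : (k <= size f)%N by apply: kmin; apply/asboolP; exists f.
  by rewrite -szg leqNgt lt.
have gdN0 : g^`().[y] != 0.
  apply/negP => /eqP gd0.
  have /small : over_S g^`().
    move=> i; rewrite coef_deriv; move: (g`_i.+1) (sg i.+1) => c sc.
    by elim: (i.+1) => [|m Sm]; rewrite ?mulr0n // mulrS; apply: SDD.
  rewrite lt_size_deriv // => /(_ gd0 isT) g'0.
  have /size1_polyC gC : (size g <= 1)%N.
    apply/leq_sizeP => -[//|j] _; have /eqP := congr1 (fun f : {poly R} => f`_j) g'0.
    by rewrite coef_deriv coef0 mulrn_eq0 => /eqP.
  by move: gN0 gy; rewrite gC hornerC polyC_eq0 => /negP + /eqP.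
pose e := - (map_poly D g).[y] / g^`().[y].
have eg : extend e g = 0 by rewrite /extend /e divfK // addrN.
exists e => f; have [m] := ubnP (size f); elim: m f => // m IH f ltm sf fy.
have [lt|le] := ltnP (size f) (size g).
  by rewrite (small f) // /extend map_poly0 deriv0 horner0 mulr0 addr0.
pose h := (lead_coef f)%:P * 'X^(size f - size g).
pose f2 := (lead_coef g)%:P * f - h * g.
have sh : over_S h by apply: over_M (over_Xn _); apply/over_C/sf.
have slg : over_S (lead_coef g)%:P by apply: over_C; apply: sg.
have sf2 : over_S f2 by apply: over_B; apply: over_M.
have g_gt0 : (0 < size g)%N by rewrite size_poly_gt0.
have f0 : (0 < size f)%N by apply: leq_trans le; rewrite size_poly_gt0.
have lt2 : (size f2 < size f)%N.
  rewrite -[X in (_ < X)%N](prednK f0) ltnS; apply/leq_sizeP => i lei.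
  rewrite /f2 /h coefB coefCM -mulrA coefCM coefXnM.
  have -> : (i < size f - size g)%N = false.
    by apply/negbTE; rewrite -leqNgt; lia.
  have [ei|ne] := eqVneq i (size f).-1.
    have -> : (i - (size f - size g) = (size g).-1)%N.
      by lia.
    by rewrite ei -!lead_coefE mulrC subrr.
  have gi : (size g <= i - (size f - size g))%N by lia.
  have fi : (size f <= i)%N by lia.
  by rewrite (nth_default _ gi) (nth_default _ fi) !mulr0 subrr.
have f2y : f2.[y] = 0 by rewrite /f2 !hornerE fy gy !mulr0 subrr.
have : extend e f2 = 0 by apply: IH => //; apply: leq_trans lt2 _.
rewrite /f2 extendB ?extendM //; try exact: over_M; last exact/over_C/sf.
rewrite fy gy eg !mul0r mulr0 !addr0 subr0 hornerC => /eqP.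
by rewrite mulf_eq0 lead_coef_eq0 (negPf gN0) => /eqP.
Qed.

Lemma adjoin_derivation : exists S' D', [/\ partial_derivation S' D',
  forall x, S x -> S' x, S' y & forall x, S x -> D' x = D x].
Proof.
have [e ext0] := extension_value.
pose S' x := exists2 f, over_S f & f.[y] = x.
pose D' x := if pselect (S' x) is left ex then extend e (projT1 (cid2 ex)) else 0.
have D'E f : over_S f -> D' f.[y] = extend e f.
  move=> sf; rewrite /D'; case: pselect => [ex|]; last by case; exists f.
  case: (cid2 ex) => g /= sg gf; apply/eqP; rewrite -subr_eq0 -extendB //.
  by rewrite ext0 //; [exact: over_B | rewrite !hornerE gf subrr].
exists S', D'; split; last 3 first.
- by move=> x sx; exists x%:P; [exact: over_C | rewrite hornerC].
- by exists 'X; [exact: over_X | rewrite hornerX].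
- move=> x sx; rewrite -{1}(hornerC x y) D'E; last exact: over_C.
  have DC : map_poly D x%:P = (D x)%:P.
    by apply/polyP => i; rewrite coef_D !coefC; case: eqP.
  by rewrite /extend derivC DC !hornerE.
split.
- by exists 1%:P; [exact: over_C | rewrite hornerC].
- move=> _ _ [f sf <-] [g sg <-]; exists (f - g); [exact: over_B | by rewrite !hornerE].
- move=> _ _ [f sf <-] [g sg <-]; exists (f * g); [exact: over_M | by rewrite !hornerE].
- move=> _ _ [f sf <-] [g sg <-]; rewrite !D'E // -extendB // -D'E ?hornerE //.
  exact: over_B.
- move=> _ _ [f sf <-] [g sg <-]; rewrite !D'E // -extendM // -D'E ?hornerE //.
  exact: over_M.
Qed.

End Adjoin.

Lemma adjoin_derivation_seq S D (ys : seq R) : partial_derivation S D ->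
  exists S' D', [/\ partial_derivation S' D', forall x, S x -> S' x,
    forall x, x \in ys -> S' x & forall x, S x -> D' x = D x].
Proof.
elim: ys S D => [|y ys IH] S D SD; first by exists S, D.
have [S1 [D1 [SD1 sub1 S1y eq1]]] := adjoin_derivation SD y.
have [S2 [D2 [SD2 sub2 S2y eq2]]] := IH _ _ SD1.
exists S2, D2; split=> // [x /sub1/sub2 //|x|x sx].
  by rewrite inE => /orP[/eqP ->|/S2y //]; exact: sub2.
by rewrite eq2 ?eq1 //; exact: sub1.
Qed.

End PartialDerivations.

(** * Stresses under generic radii *)

Lemma partial_derivationD (R : numFieldType) (S : R -> Prop) D x y :
  partial_derivation S D -> S x -> S y -> S (x + y) /\ D (x + y) = D x + D y.
Proof.
case=> S1 SB SM DB DM sx sy.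
have S0 : S 0 by rewrite -(subrr 1); exact: SB.
have D0 : D 0 = 0 by have := DB _ _ S0 S0; rewrite !subrr.
have Sy : S (- y) by rewrite -sub0r; exact: SB.
have -> : x + y = x - (- y) by rewrite opprK.
split; first exact: SB.
by rewrite DB // -[in D (- y)]sub0r DB // D0 sub0r opprK.
Qed.

Section Generic.
Variable R : realType.

(** Genericity makes evaluation at [x] injective, so that the directional derivative
    of polynomials descends to the subring generated by [x]. *)
Lemma generic_derivation N (x s : 'I_N -> R) : generic x ->
  exists S D, [/\ partial_derivation S D, forall i, S (x i) & forall i, D (x i) = s i].
Proof.
move=> gen.
pose ev (q : mpoly.mpoly N rat) : R := mpoly.mmap (@ratr R) x q.
pose S y := exists q, ev q = y.
pose dq q := \sum_i s i * ev (mpoly.mderiv i q).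
pose D y := if pselect (S y) is left ex then dq (projT1 (cid ex)) else 0.
have evB u v : ev (u - v) = ev u - ev v by rewrite /ev mpoly.mmapB.
have evM u v : ev (u * v) = ev u * ev v by rewrite /ev rmorphM.
have DE q : D (ev q) = dq q.
  rewrite /D; case: pselect => [ex|]; last by case; exists q.
  case: (cid ex) => q' /= e; suff -> : q' = q by [].
  by apply/eqP; rewrite -subr_eq0; apply/eqP/gen; rewrite -/(ev _) evB e subrr.
pose X i : mpoly.mpoly N rat := mpoly.mpolyX rat (mpoly.mnm1 i).
have evX i : ev (X i) = x i by rewrite /ev mpoly.mmapX mpoly.mmap1U.
exists S, D; split.
- split.
  + by exists 1; rewrite /ev rmorph1.
  + by move=> _ _ [u <-] [v <-]; exists (u - v).
  + by move=> _ _ [u <-] [v <-]; exists (u * v).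
  + move=> _ _ [u <-] [v <-]; rewrite -evB !DE /dq -sumrB.
    by apply: eq_bigr => i _; rewrite mpoly.mderivB evB mulrBr.
  + move=> _ _ [u <-] [v <-]; rewrite -evM !DE /dq !mulr_sumr -big_split /=.
    apply: eq_bigr => i _; rewrite mpoly.mderivM /ev mpoly.mmapD !rmorphM /=.
    by rewrite -!/(ev _); ring.
- by move=> i; exists (X i).
- move=> i; rewrite -evX DE /dq (bigD1 i) //= [X in _ + X]big1 ?addr0.
    rewrite /X mpoly.mderivX mpoly.mnm1E eqxx scale1r.
    have -> : (mpoly.mnm_sub (mpoly.mnm1 i) (mpoly.mnm1 i)) = mpoly.mnm0.
      by apply/mpoly.mnmP => k; rewrite mpoly.mnmBE subnn mpoly.mnm0E.
    by rewrite /ev mpoly.mmapX mpoly.mmap11 mulr1.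
  move=> k ki; rewrite /X mpoly.mderivX mpoly.mnm1E eq_sym (negPf ki) scale0r.
  by rewrite /ev mpoly.mmap0 mulr0.
Qed.

(** The two notions of genericity give the same freedom up to a multiple of [r],
    which corresponds to scaling the packing. *)
Lemma generic_radii_derivation n (hn : (2 <= n)%N) (r : 'I_n -> R) :
  (forall i, 0 < r i) -> generic r \/ generic (radii_ratios hn r) ->
  forall s : 'I_n -> R, s (last_index hn) = 0 -> forall ys : seq R,
  exists S D c, [/\ partial_derivation S D, forall i, S (r i),
    forall y, y \in ys -> S y & forall i, D (r i) = s i + c * r i].
Proof.
move=> r0 [gen|gen] s s0 ys.
  have [S [D [SD Sr Dr]]] := generic_derivation s gen.
  have [S' [D' [SD' sub Sys eqD]]] := adjoin_derivation_seq ys SD.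
  exists S', D', 0; split=> // [i|i]; first exact: sub.
  by rewrite mul0r addr0 eqD.
set l := last_index hn in s0 *.
pose sigma (i : 'I_n.-1) := s (widen_ord (leq_pred n) i) / r l.
have [S [D [SD Sr Dr]]] := generic_derivation sigma gen.
have [S' [D' [SD' sub Sys eqD]]] := adjoin_derivation_seq (r l :: ys) SD.
have Sl : S' (r l) by apply: Sys; rewrite mem_head.
have ri i : (exists2 k, i = widen_ord (leq_pred n) k & r i = radii_ratios hn r k * r l)
    \/ i = l.
  have [lt|ge] := ltnP i n.-1; last first.
    right; apply/val_inj => /=; apply/eqP; rewrite eqn_leq ge andbT.
    by rewrite -ltnS prednK ?ltn_ord // ltnW.
  left; exists (Ordinal lt); first exact: val_inj.
  rewrite /radii_ratios divfK ?gt_eqF //.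
  by congr r; apply: val_inj.
case: (SD') => _ _ SM _ DM.
have SM' k : S' (radii_ratios hn r k) by apply: sub.
exists S', D', (D' (r l) / r l); split=> // [i|y ys_y|i].
- by case: (ri i) => [[k _ ->]|->] //; exact: SM.
- by apply: Sys; rewrite inE ys_y orbT.
- case: (ri i) => [[k ik ri_eq]|->]; last by rewrite s0 add0r divfK // gt_eqF.
  rewrite ri_eq DM // (eqD _ (Sr k)) Dr /sigma -ik; field.
  by rewrite gt_eqF.
Qed.

End Generic.

Lemma sym_sum_sub (R : realFieldType) (T : finType) (w : T -> T -> R) (x y : T -> R) :
  (forall i j, w i j = w j i) ->
  \sum_i \sum_j w i j * ((x i - x j) * (y i - y j)) =
  2 * \sum_i y i * \sum_j w i j * (x i - x j).
Proof.
move=> wC; have -> : \sum_i \sum_j w i j * ((x i - x j) * (y i - y j)) =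
   \sum_i \sum_j y i * (w i j * (x i - x j)) + \sum_i \sum_j y j * (w j i * (x j - x i)).
  rewrite -big_split; apply: eq_bigr => i _ /=; rewrite -big_split /=.
  by apply: eq_bigr => j _; rewrite (wC j i); ring.
rewrite [X in _ + X]exchange_big /= mulr2n mulrDl mul1r.
by under eq_bigr do rewrite -mulr_sumr.
Qed.

Lemma sym_sum_add (R : realFieldType) (T : finType) (w : T -> T -> R) (x y : T -> R) :
  (forall i j, w i j = w j i) ->
  \sum_i \sum_j w i j * ((x i + x j) * (y i + y j)) =
  2 * \sum_i y i * \sum_j w i j * (x i + x j).
Proof.
move=> wC; have -> : \sum_i \sum_j w i j * ((x i + x j) * (y i + y j)) =
   \sum_i \sum_j y i * (w i j * (x i + x j)) + \sum_i \sum_j y j * (w j i * (x j + x i)).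
  rewrite -big_split; apply: eq_bigr => i _ /=; rewrite -big_split /=.
  by apply: eq_bigr => j _; rewrite (wC j i); ring.
rewrite [X in _ + X]exchange_big /= mulr2n mulrDl mul1r.
by under eq_bigr do rewrite -mulr_sumr.
Qed.

(** The centers enter through their coordinates [a] and [b].  Each choice of
    derivatives of the radii extends to a derivation defined at all coordinates,
    and the stress annihilates the derivatives of the squared distances. *)
Lemma stress_balances_radii (R : realType) n (hn : (2 <= n)%N) (r a b : 'I_n -> R)
    (w : 'I_n -> 'I_n -> R) :
  (forall i, 0 < r i) -> generic r \/ generic (radii_ratios hn r) ->
  (forall i j, w i j = w j i) ->
  (forall i j, w i j != 0 ->
     (a i - a j) ^+ 2 + (b i - b j) ^+ 2 = (r i + r j) ^+ 2) ->
  (forall i, \sum_j w i j * (a i - a j) = 0) ->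
  (forall i, \sum_j w i j * (b i - b j) = 0) ->
  forall i, \sum_j w i j * (r i + r j) = 0.
Proof.
move=> r0 gen wC len wa wb.
set e := fun i => \sum_j w i j * (r i + r j).
have orth (y : 'I_n -> R) (x z : 'I_n -> R) :
    (forall i j, w i j != 0 -> (a i - a j) * (x i - x j) + (b i - b j) * (z i - z j) =
       (r i + r j) * (y i + y j)) -> \sum_i y i * e i = 0.
  move=> eqs; apply: (mulfI (lt0r_neq0 (ltr0n R 2))); rewrite mulr0 -sym_sum_add //.
  transitivity (\sum_i \sum_j w i j * ((a i - a j) * (x i - x j)) +
                \sum_i \sum_j w i j * ((b i - b j) * (z i - z j))).
    rewrite -big_split; apply: eq_bigr => i _ /=; rewrite -big_split /=.
    apply: eq_bigr => j _; rewrite -mulrDr.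
    by have [->|/eqs ->] := eqVneq (w i j) 0; rewrite ?mul0r.
  rewrite !sym_sum_sub // ![\sum_i _ * \sum_j _]big1 ?mulr0 ?addr0 // => i _.
    by rewrite wb mulr0.
  by rewrite wa mulr0.
(* scaling: the centers themselves are the velocities of a dilation *)
have er : \sum_i r i * e i = 0.
  by apply: (orth r a b) => i j wij; rewrite -!expr2 len.
have ortho (s : 'I_n -> R) : s (last_index hn) = 0 -> \sum_i s i * e i = 0.
  move=> s0.
  have [S [D [c [SD Sr Sab Dr]]]] :=
    generic_radii_derivation r0 gen s0 (codom a ++ codom b).
  have Sa i : S (a i) by apply: Sab; rewrite mem_cat codom_f.
  have Sb i : S (b i) by apply: Sab; rewrite mem_cat codom_f orbT.
  case: (SD) => _ SB SM DB DM.
  have : \sum_i D (r i) * e i = 0.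
    apply: (orth (D \o r) (D \o a) (D \o b)) => i j wij /=.
    have [Srr Drr] := partial_derivationD SD (Sr i) (Sr j).
    have [_] := partial_derivationD SD (SM _ _ (SB _ _ (Sa i) (Sa j)) (SB _ _ (Sa i) (Sa j)))
      (SM _ _ (SB _ _ (Sb i) (Sb j)) (SB _ _ (Sb i) (Sb j))).
    rewrite -!expr2 len // !expr2 !DM ?Drr ?DB //; try exact: SB.
    by lra.
  under eq_bigr do rewrite Dr mulrDl -mulrA.
  by rewrite big_split /= -mulr_sumr er mulr0 addr0.
have e0 i : i != last_index hn -> e i = 0.
  move=> il; have := ortho (fun k => (k == i)%:R).
  rewrite eq_sym (negPf il) => /(_ erefl); rewrite (bigD1 i) //= eqxx mul1r.
  by rewrite big1 ?addr0 // => k /negPf ->; rewrite mul0r.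
move=> i; have [->|/e0 //] := eqVneq i (last_index hn).
move: er; rewrite (bigD1 (last_index hn)) //= big1 ?addr0 => [/eqP|k /e0 ->].
  by rewrite mulf_eq0 gt_eqF //= => /eqP.
by rewrite mulr0.
Qed.

Local Open Scope classical_set_scope.
Local Open Scope ring_scope.

(** * Geometry of tangent disks *)

Section Segments.
Variables (R : realFieldType) (T : eqType) (a b r : T -> R).
Hypothesis r_gt0 : forall i, 0 < r i.
Let d2 i j := (a i - a j) ^+ 2 + (b i - b j) ^+ 2.
Hypothesis sep : forall i j, i != j -> (r i + r j) ^+ 2 <= d2 i j.

(** The equality case of the triangle inequality.  The identity in the proof writes
    a sum of nonnegative terms as 0. *)
Lemma tangent_point (u1 u2 v1 v2 x y : R) : 0 < x -> 0 < y ->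
  u1 ^+ 2 + u2 ^+ 2 <= x ^+ 2 -> v1 ^+ 2 + v2 ^+ 2 <= y ^+ 2 ->
  (x + y) ^+ 2 <= (u1 + v1) ^+ 2 + (u2 + v2) ^+ 2 ->
  [/\ u1 ^+ 2 + u2 ^+ 2 = x ^+ 2, v1 ^+ 2 + v2 ^+ 2 = y ^+ 2,
      y * u1 = x * v1 & y * u2 = x * v2].
Proof.
move=> x0 y0 hu hv huv.
set U := u1 ^+ 2 + u2 ^+ 2 in hu *; set V := v1 ^+ 2 + v2 ^+ 2 in hv *.
have e : (y * u1 - x * v1) ^+ 2 + (y * u2 - x * v2) ^+ 2 +
    x * y * ((u1 + v1) ^+ 2 + (u2 + v2) ^+ 2 - (x + y) ^+ 2) +
    (x + y) * y * (x ^+ 2 - U) + (x + y) * x * (y ^+ 2 - V) = 0.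
  by rewrite /U /V; ring.
have s1 : 0 <= (y * u1 - x * v1) ^+ 2 := sqr_ge0 _.
have s2 : 0 <= (y * u2 - x * v2) ^+ 2 := sqr_ge0 _.
have s3 : 0 <= x * y * ((u1 + v1) ^+ 2 + (u2 + v2) ^+ 2 - (x + y) ^+ 2).
  by rewrite mulr_ge0 ?subr_ge0 // mulr_ge0 // ltW.
have s4 : 0 <= (x + y) * y * (x ^+ 2 - U).
  by rewrite mulr_ge0 ?subr_ge0 // mulr_ge0 ?addr_ge0 // ltW.
have s5 : 0 <= (x + y) * x * (y ^+ 2 - V).
  by rewrite mulr_ge0 ?subr_ge0 // mulr_ge0 ?addr_ge0 // ltW.
have xy : 0 < x + y by rewrite addr_gt0.
split.
- have : (x + y) * y * (x ^+ 2 - U) == 0 by apply/eqP; lra.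
  by rewrite !mulf_eq0 (gt_eqF xy) (gt_eqF y0) /= subr_eq0 => /eqP.
- have : (x + y) * x * (y ^+ 2 - V) == 0 by apply/eqP; lra.
  by rewrite !mulf_eq0 (gt_eqF xy) (gt_eqF x0) /= subr_eq0 => /eqP.
- by apply/eqP; rewrite -subr_eq0 -sqrf_eq0; apply/eqP; lra.
- by apply/eqP; rewrite -subr_eq0 -sqrf_eq0; apply/eqP; lra.
Qed.

(** Two disks that touch the disk [i] in the same direction would overlap, as their
    centers would be at distance |r j - r k|. *)
Lemma same_direction i j k (e1 e2 : R) :
  e1 ^+ 2 + e2 ^+ 2 = 1 ->
  a j - a i = (r i + r j) * e1 -> b j - b i = (r i + r j) * e2 ->
  a k - a i = (r i + r k) * e1 -> b k - b i = (r i + r k) * e2 -> j = k.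
Proof.
move=> e ej1 ej2 ek1 ek2; apply/eqP/negPn/negP => jk.
have := sep jk; rewrite /d2.
have -> : a j - a k = (r j - r k) * e1 by lra.
have -> : b j - b k = (r j - r k) * e2 by lra.
rewrite !exprMn -mulrDr e mulr1 => h.
have := mulr_gt0 (r_gt0 j) (r_gt0 k); move: h; rewrite !expr2.
by nra.
Qed.

Definition touch i j := i != j /\ d2 i j = (r i + r j) ^+ 2.

Lemma touch_sym i j : touch i j -> touch j i.
Proof.
by case=> ij e; split; [rewrite eq_sym | rewrite addrC -e /d2 -(opprB (a i)) -(opprB (b i)) !sqrrN].
Qed.

(** A meeting point in the disks of [i] and [k] is, if i <> k, their tangency
    point, so both segments point from one of these centers to the other. *)
Lemma segments_meet_near i j k m (s t : R) : touch i j -> touch k m ->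
  0 <= s -> s * (r i + r j) <= r i -> 0 <= t -> t * (r k + r m) <= r k ->
  a i + s * (a j - a i) = a k + t * (a m - a k) ->
  b i + s * (b j - b i) = b k + t * (b m - b k) ->
  [\/ (i, j) = (k, m), (i, j) = (m, k) | s = 0 /\ t = 0].
Proof.
move=> ijt kmt s0 si t0 tk ea eb.
have [ij dij] := ijt; have [km dkm] := kmt.
have rij : 0 < r i + r j by rewrite addr_gt0.
have rkm : 0 < r k + r m by rewrite addr_gt0.
have unit x y : touch x y -> ((a y - a x) / (r x + r y)) ^+ 2 +
    ((b y - b x) / (r x + r y)) ^+ 2 = 1.
  move=> [_ dxy]; have : 0 < r x + r y by rewrite addr_gt0.
  rewrite -(opprB (a x)) -(opprB (b x)) !mulNr !sqrrN !expr_div_n -mulrDl -/(d2 x y) dxy => h.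
  by rewrite divff // expf_neq0 // gt_eqF.
have self (x A : R) : A != 0 -> x = A * (x / A) by move=> A0; rewrite mulrC divfK.
have other (x y c A B : R) : c != 0 -> A != 0 -> c * A * y = B * (c * x) -> y = B * (x / A).
  by move=> c0 A0 e; apply: (mulfI (mulf_neq0 c0 A0)); rewrite e; field.
have rij0 := lt0r_neq0 rij; have rkm0 := lt0r_neq0 rkm.
have [eik|ik] := eqVneq i k.
  subst k; have {}ea : s * (a j - a i) = t * (a m - a i) by lra.
  have {}eb : s * (b j - b i) = t * (b m - b i) by lra.
  have st : s * (r i + r j) = t * (r i + r m).
    apply/eqP; rewrite -(@eqrXn2 _ 2) //; try by rewrite mulr_ge0 // ltW.
    rewrite !exprMn -dij -dkm /d2 !mulrDr -!exprMn.
    by rewrite -(opprB (a j)) -(opprB (b j)) -(opprB (a m)) -(opprB (b m)) !mulrN !sqrrN ea eb.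
  have [sz|sN0] := eqVneq s 0.
    apply: Or33; split=> //; move: st; rewrite sz mul0r => /esym/eqP.
    by rewrite mulf_eq0 (gt_eqF rkm) orbF => /eqP.
  apply: Or31; congr pair.
  apply: (same_direction (unit _ _ ijt)); try exact: self.
    by apply: (other _ _ _ _ _ sN0 rij0); rewrite ea st; ring.
  by apply: (other _ _ _ _ _ sN0 rij0); rewrite eb st; ring.
have ui : (s * (a j - a i)) ^+ 2 + (s * (b j - b i)) ^+ 2 = (s * (r i + r j)) ^+ 2.
  by rewrite !exprMn -mulrDr -dij /d2 -(opprB (a j)) -(opprB (b j)) !sqrrN.
have vk : (t * (a m - a k)) ^+ 2 + (t * (b m - b k)) ^+ 2 = (t * (r k + r m)) ^+ 2.
  by rewrite !exprMn -mulrDr -dkm /d2 -(opprB (a m)) -(opprB (b m)) !sqrrN.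
have [] := @tangent_point (s * (a j - a i)) (s * (b j - b i))
    (- (t * (a m - a k))) (- (t * (b m - b k))) (r i) (r k) (r_gt0 i) (r_gt0 k).
- by rewrite ui lerXn2r // nnegrE ?mulr_ge0 // ltW.
- by rewrite !sqrrN vk lerXn2r // nnegrE ?mulr_ge0 // ltW.
- apply: le_trans (sep ik) _; rewrite /d2.
  have -> : s * (a j - a i) - t * (a m - a k) = - (a i - a k) by lra.
  have -> : s * (b j - b i) - t * (b m - b k) = - (b i - b k) by lra.
  by rewrite !sqrrN.
have si0 : 0 <= s * (r i + r j) by rewrite mulr_ge0 // ltW.
have tk0 : 0 <= t * (r k + r m) by rewrite mulr_ge0 // ltW.
rewrite ui !sqrrN vk => /eqP; rewrite eqrXn2 ?(ltW (r_gt0 i)) // => /eqP sE.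
move=> /eqP; rewrite eqrXn2 ?(ltW (r_gt0 k)) // => /eqP tE.
rewrite !mulrN => e1 e2.
have rk0 := r_gt0 k; have ri0 := r_gt0 i.
have sN0 : s != 0 by apply: contraTneq ri0 => s0'; rewrite -sE s0' mul0r ltxx.
have tN0 : t != 0 by apply: contraTneq rk0 => t0'; rewrite -tE t0' mul0r ltxx.
have jk : j = k.
  apply: (same_direction (unit _ _ ijt)); try exact: self.
    apply: (other _ _ _ _ _ sN0 rij0).
    by rewrite sE mulrDl e1 -mulrBr; congr (_ * _); lra.
  apply: (other _ _ _ _ _ sN0 rij0).
  by rewrite sE mulrDl e2 -mulrBr; congr (_ * _); lra.
have mi : m = i.
  apply: (same_direction (unit _ _ kmt)); try exact: self.
    apply: (other _ _ _ _ _ tN0 rkm0).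
    by rewrite tE mulrDl -[r i * _]opprK -e1 -mulrBr; congr (_ * _); lra.
  apply: (other _ _ _ _ _ tN0 rkm0).
  by rewrite tE mulrDl -[r i * _]opprK -e2 -mulrBr; congr (_ * _); lra.
by apply: Or32; rewrite jk mi.
Qed.
End Segments.

(** Each point of a contact segment lies in one of the two disks; reversing
    segments reduces to [segments_meet_near]. *)
Lemma segments_meet (R : realFieldType) (T : eqType) (a b r : T -> R) :
  (forall i, 0 < r i) ->
  (forall i j, i != j -> (r i + r j) ^+ 2 <= (a i - a j) ^+ 2 + (b i - b j) ^+ 2) ->
  forall i j k m (s t : R), touch a b r i j -> touch a b r k m ->
  0 <= s <= 1 -> 0 <= t <= 1 ->
  a i + s * (a j - a i) = a k + t * (a m - a k) ->
  b i + s * (b j - b i) = b k + t * (b m - b k) ->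
  [\/ (i, j) = (k, m), (i, j) = (m, k)
    | (s = 0 \/ s = 1) /\ (t = 0 \/ t = 1)].
Proof.
move=> r0 sep i j k m s t ij km /andP[s0 s1] /andP[t0 t1] ea eb.
have near (x y u : R) : 0 <= u <= 1 -> u * (x + y) <= x \/ (1 - u) * (y + x) <= y.
  by move=> u01; case: (leP (u * (x + y)) x); [left | right; lra].
have s01 : 0 <= 1 - s by rewrite subr_ge0.
have t01 : 0 <= 1 - t by rewrite subr_ge0.
have s1' : 1 - s = 0 -> s = 1 by move=> ?; lra.
have t1' : 1 - t = 0 -> t = 1 by move=> ?; lra.
have [ns|ns] := near (r i) (r j) s ltac:(by apply/andP);
have [nt|nt] := near (r k) (r m) t ltac:(by apply/andP).
- have [] := segments_meet_near r0 sep ij km s0 ns t0 nt ea eb; first exact: Or31.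
    exact: Or32.
  by case=> *; apply: Or33; split; left.
- have [||[-> ->]|[-> ->]|] := segments_meet_near r0 sep ij (touch_sym km) s0 ns t01 nt.
  + by rewrite ea; ring.
  + by rewrite eb; ring.
  + exact: Or32.
  + exact: Or31.
  + by case=> ? /t1' ?; apply: Or33; split; [left | right].
- have [||[-> ->]|[-> ->]|] := segments_meet_near r0 sep (touch_sym ij) km s01 ns t0 nt.
  + by rewrite -ea; ring.
  + by rewrite -eb; ring.
  + exact: Or32.
  + exact: Or31.
  + by case=> /s1' ? ?; apply: Or33; split; [right | left].
- have [||[-> ->]|[-> ->]|] :=
    segments_meet_near r0 sep (touch_sym ij) (touch_sym km) s01 ns t01 nt.
  + by transitivity (a i + s * (a j - a i)); [ring | rewrite ea; ring].
  + by transitivity (b i + s * (b j - b i)); [ring | rewrite eb; ring].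
  + exact: Or31.
  + exact: Or32.
  + by case=> /s1' ? /t1' ?; apply: Or33; split; right.
Qed.

Section Packings.
Variable R : realType.
Implicit Types (u v c x : 'rV[R]_2).

Lemma dotpE u v : dotp u v = u 0 0 * v 0 0 + u 0 1 * v 0 1.
Proof.
by rewrite /dotp !big_ord_recl big_ord0 addr0; congr (_ + _ * _);
  congr (_ _ _); apply: val_inj.
Qed.

Lemma dotp_ge0 u : 0 <= dotp u u.
Proof. by rewrite dotpE addr_ge0 // -expr2 sqr_ge0. Qed.

Lemma enorm_le u (x : R) : 0 <= x -> (enorm u <= x) = (dotp u u <= x ^+ 2).
Proof. by move=> x0; rewrite /enorm -{1}(ger0_norm x0) -sqrtr_sqr ler_sqrt ?sqr_ge0. Qed.

Lemma enorm_eq u (x : R) : 0 <= x -> (enorm u == x) = (dotp u u == x ^+ 2).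
Proof.
move=> x0; rewrite -{1}(ger0_norm x0) -sqrtr_sqr /enorm.
by apply/eqP/eqP => [|->//] /(congr1 (fun y => y ^+ 2)); rewrite !sqr_sqrtr ?sqr_ge0 ?dotp_ge0.
Qed.

Lemma continuous_dotp_sub c : continuous (fun x => dotp (x - c) (x - c)).
Proof.
have -> : (fun x => dotp (x - c) (x - c)) =
    (fun x => (x 0 0 - c 0 0) * (x 0 0 - c 0 0) + (x 0 1 - c 0 1) * (x 0 1 - c 0 1)).
  by apply/funext => x; rewrite dotpE !mxE.
move=> x.
have sub_cont k : (fun y : 'rV[R]_2 => y 0 k - c 0 k) @ x --> x 0 k - c 0 k.
  apply: (@cvgB _ _ _ (nbhs x) _ (fun y : 'rV[R]_2 => y 0 k) (cst (c 0 k))).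
    exact: coord_continuous.
  exact: cvg_cst.
exact: (cvgD (cvgM (sub_cont 0) (sub_cont 0)) (cvgM (sub_cont 1) (sub_cont 1))).
Qed.

(** If two disks overlap, the point dividing the segment of their centers in the
    ratio of the radii is interior to both; conversely, a common interior point
    could be moved away from one center, against [tangent_point]. *)
Lemma packing_separated n (p : 'I_n -> 'rV[R]_2) (r : 'I_n -> R) :
  is_packing p r <->
  (forall i, 0 < r i) /\
  (forall i j, i != j -> (r i + r j) ^+ 2 <= dotp (p i - p j) (p i - p j)).
Proof.
split=> -[r0 dis]; split=> // i j ij; last first.
  apply/seteqP; split=> // x [xi xj] /=.
  have nx : nbhs x [set y | disk (p i) (r i) y /\ disk (p j) (r j) y].
    exact: filterI xi xj.
  (* A common interior point remains common when moved away from the first center,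
     but [tangent_point] puts it on the boundary of the first disk. *)
  pose f (d : R) : 'rV[R]_2 := x + d *: (x - p i).
  have cf : f d @[d --> (0 : R)] --> x.
    rewrite -[X in _ --> X]addr0 -[X in _ + X](scale0r (x - p i)).
    apply: cvgD; first exact: cvg_cst.
    by apply: cvgZr_tmp; exact: cvg_id.
  have /nbhs_ballP[e /= e0 eball] := cf _ nx.
  have tan d : `|d| < e -> dotp (f d - p i) (f d - p i) = r i ^+ 2.
    move=> de; have [] := eball d.
      by rewrite /ball /= sub0r normrN.
    move: (f d) => z; rewrite /disk /= !enorm_le ?(ltW (r0 _)) //.
    rewrite !dotpE !mxE -!expr2 => h1 h2.
    have := dis i j ij; rewrite dotpE !mxE -!expr2 => hd.
    have [] // := @tangent_point _ _ _ (p j 0 0 - z 0 0) (p j 0 1 - z 0 1) _ _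
        (r0 i) (r0 j) h1.
      by rewrite -(opprB (z 0 0)) -(opprB (z 0 1)) !sqrrN.
    apply: le_trans hd _; rewrite -(opprB (p j 0 0)) -(opprB (p j 0 1)) !sqrrN.
    by rewrite le_eqVlt; apply/orP; left; apply/eqP; ring.
  have := tan 0; rewrite normr0 => /(_ e0).
  have := tan (e / 2); rewrite ger0_norm ?divr_ge0 ?ltW // => /(_ _).
  rewrite ltr_pdivrMr ?ltr_pMr ?ltr1n // => /(_ isT).
  rewrite /f !dotpE !mxE mul0r addr0.
  set A := x 0 0 - _; set B := x 0 1 - _ => h1 h2.
  have : (1 + e / 2) ^+ 2 * r i ^+ 2 = r i ^+ 2.
    by rewrite -{2}h1 -h2 /A /B; ring.
  have := r0 i => ri; have : 0 < r i ^+ 2 by rewrite exprn_gt0.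
  by nra.
rewrite leNgt; apply/negP => lt.
have rij : 0 < r i + r j by rewrite addr_gt0.
pose s := r i / (r i + r j).
pose x : 'rV[R]_2 := p i + s *: (p j - p i).
have inside c (rho : R) : 0 < rho -> dotp (x - c) (x - c) < rho ^+ 2 -> (disk c rho)^° x.
  move=> rho0 xlt; rewrite /interior.
  have : \forall y \near x, dotp (y - c) (y - c) < rho ^+ 2.
    by have := @cvgr_lt _ _ _ _ _ _ (@continuous_dotp_sub c x) _ xlt; apply.
  by apply: filterS => y yl; rewrite /disk /= enorm_le ?ltW.
suff : set0 x by [].
have D0 := dotp_ge0 (p i - p j).
rewrite -(dis i j ij); split; apply: inside => //.
  have -> : dotp (x - p i) (x - p i) = s ^+ 2 * dotp (p i - p j) (p i - p j).
    by rewrite !dotpE !mxE; ring.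
  have -> : r i ^+ 2 = s ^+ 2 * (r i + r j) ^+ 2.
    by rewrite -exprMn divfK // gt_eqF.
  by rewrite ltr_pM2l // exprn_gt0 // divr_gt0.
have -> : dotp (x - p j) (x - p j) = (1 - s) ^+ 2 * dotp (p i - p j) (p i - p j).
  by rewrite !dotpE !mxE; ring.
have e1 : 1 - s = r j / (r i + r j) by rewrite /s; field; rewrite gt_eqF.
have -> : r j ^+ 2 = (1 - s) ^+ 2 * (r i + r j) ^+ 2.
  by rewrite -exprMn e1 divfK // gt_eqF.
by rewrite ltr_pM2l // e1 exprn_gt0 // divr_gt0.
Qed.

End Packings.

(** * Contact graphs are planar and carry no stress *)

(** Only finitely many directions give two points the same height. *)
Lemma generic_height (R : realFieldType) (T : finType) (a b : T -> R) :
  (forall i j, a i = a j -> b i = b j -> i = j) ->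
  exists y : R, injective (fun i => y * a i + b i).
Proof.
move=> inj; pose bad i j := `|(b j - b i) / (a i - a j)|.
pose y := 1 + \sum_i \sum_j bad i j.
have bad_lt i j : bad i j < y.
  rewrite /y (bigD1 i) //= (bigD1 j) //=.
  have s1 : 0 <= \sum_(k | k != j) bad i k by apply: sumr_ge0 => *; exact: normr_ge0.
  have s2 : 0 <= \sum_(k | k != i) \sum_j bad k j.
    by apply: sumr_ge0 => *; apply: sumr_ge0 => *; exact: normr_ge0.
  by lra.
exists y => i j e.
have [aij|aij] := eqVneq (a i) (a j); first by apply: inj => //; move: e; rewrite aij; lra.
have : y = (b j - b i) / (a i - a j).
  have e' : y * (a i - a j) = b j - b i by lra.
  by rewrite -e' mulfK // subr_eq0.
by have := bad_lt i j => /[swap] yE; rewrite /bad -yE => /ltr_normlW; rewrite ltxx.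
Qed.

Section Contacts.
Variables (R : realType) (n : nat) (p : 'I_n -> 'rV[R]_2) (r : 'I_n -> R).
Hypothesis hP : is_packing p r.

Let a i := p i 0 0.
Let b i := p i 0 1.

Lemma packing_r_gt0 i : 0 < r i.
Proof. by case/packing_separated: hP. Qed.

Lemma dotp_sub i j : dotp (p i - p j) (p i - p j) = (a i - a j) ^+ 2 + (b i - b j) ^+ 2.
Proof. by rewrite dotpE !mxE -!expr2. Qed.

Lemma packing_coord_sep i j : i != j -> (r i + r j) ^+ 2 <= (a i - a j) ^+ 2 + (b i - b j) ^+ 2.
Proof. by case/packing_separated: hP => _ sep ij; rewrite -dotp_sub sep. Qed.

Lemma contactE i j :
  contact p r i j = (i != j) && (dotp (p i - p j) (p i - p j) == (r i + r j) ^+ 2).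
Proof. by rewrite /contact enorm_eq // addr_ge0 // ltW ?packing_r_gt0. Qed.

Lemma contact_sym i j : contact p r i j = contact p r j i.
Proof.
rewrite !contactE eq_sym (addrC (r i)); congr (_ && (_ == _)).
by rewrite !dotpE !mxE; ring.
Qed.

Lemma contact_touch i j : contact p r i j -> touch a b r i j.
Proof. by rewrite contactE dotp_sub => /andP[? /eqP]. Qed.

Lemma contacts_meet i j k m (s t : R) : contact p r i j -> contact p r k m ->
  0 <= s <= 1 -> 0 <= t <= 1 ->
  p i + s *: (p j - p i) = p k + t *: (p m - p k) ->
  [\/ (i, j) = (k, m), (i, j) = (m, k)
    | (s = 0 \/ s = 1) /\ (t = 0 \/ t = 1)].
Proof.
move=> /contact_touch ij /contact_touch km s01 t01 e.
have coord l : p i 0 l + s * (p j 0 l - p i 0 l) = p k 0 l + t * (p m 0 l - p k 0 l).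
  by have := congr1 (fun v : 'rV[R]_2 => v 0 l) e; rewrite !mxE.
exact: (segments_meet packing_r_gt0 packing_coord_sep ij km s01 t01 (coord 0) (coord 1)).
Qed.

Lemma centers_inj : injective p.
Proof.
move=> i j e; apply/eqP/negPn/negP => /packing_coord_sep.
rewrite /a /b e !subrr !expr0n addr0 leNgt exprn_gt0 // addr_gt0 //; exact: packing_r_gt0.
Qed.

Lemma contact_irr i j : contact p r i j -> i != j.
Proof. by case/andP. Qed.

Lemma contact_edge i j : contact p r i j -> [set i; j]%SET \in edges (contact p r).
Proof.
move=> ij; rewrite inE; apply/existsP; exists i; apply/existsP; exists j.
by rewrite (contact_irr ij) ij eqxx.
Qed.

Lemma edgesP (e : {set 'I_n}) : e \in edges (contact p r) ->
  exists i j, contact p r i j /\ e = [set i; j]%SET.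
Proof.
by rewrite inE => /existsP[i /existsP[j /and3P[_ ij /eqP ->]]]; exists i, j.
Qed.

(** The drawing by straight segments.  A center on a contact segment would be too
    close to one of its ends. *)
Lemma contact_planar : planar R (contact p r).
Proof.
pose ends (e : {set 'I_n}) (ij : 'I_n * 'I_n) :=
  contact p r ij.1 ij.2 && (e == [set ij.1; ij.2]%SET).
have [f fP] : exists f : {set 'I_n} -> 'rV[R]_2 * 'rV[R]_2,
    forall e, e \in edges (contact p r) -> exists2 ij, ends e ij & f e = (p ij.1, p ij.2).
  pose P (e : {set 'I_n}) (y : 'rV[R]_2 * 'rV[R]_2) :=
    e \in edges (contact p r) -> exists2 ij, ends e ij & y = (p ij.1, p ij.2).
  suff /choice[f fP] : forall e, exists y, P e y by exists f.
  move=> e; have [/edgesP[i [j [cij ->]]]|] := boolP (e \in edges (contact p r)); last first.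
    by move=> /negPf eF; exists (0, 0); rewrite /P eF.
  by exists (p i, p j) => _; exists (i, j) => //; rewrite /ends cij /=.
pose arc e (t : R) := (f e).1 + t *: ((f e).2 - (f e).1).
have in01 (t : R) : t \in `[0, 1] -> 0 <= t <= 1 by rewrite in_itv.
have inoo (t : R) : t \in `]0, 1[ -> [/\ 0 <= t <= 1, t <> 0 & t <> 1].
  by rewrite in_itv /= => /andP[t0 t1]; split; [rewrite !ltW | move=> h; lra | move=> h; lra].
exists p, arc; split.
- exact: centers_inj.
- move=> e /fP[[i j] /= /andP[/= cij /eqP ->] fe]; rewrite /arc fe /=.
  split.
  + apply: continuous_subspaceT => t; apply: cvgD; first exact: cvg_cst.
    by apply: cvgZr_tmp; exact: cvg_id.
  + move=> s t _ _ /addrI /eqP; rewrite -subr_eq0 -scalerBl scaler_eq0 !subr_eq0.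
    case/orP => [/eqP //|/eqP /centers_inj ji]; move: cij.
    by rewrite ji contactE eqxx.
  + rewrite scale0r addr0 scale1r addrC subrK; apply/seteqP; split=> x /=.
      case=> ->; [exists i | exists j] => //=; by rewrite !inE eqxx ?orbT.
    by case=> k /=; rewrite !inE => /orP[] /eqP -> <-; [left | right].
- move=> e /fP[[i j] /= /andP[/= cij _] fe] t k /inoo[t01 t0 t1]; rewrite /arc fe /= => ek.
  have coord l : p k 0 l = p i 0 l + t * (p j 0 l - p i 0 l).
    by rewrite -ek !mxE.
  have /contact_touch[_ dij] := cij.
  have rk0 := packing_r_gt0 k; have ri0 := packing_r_gt0 i; have rj0 := packing_r_gt0 j.
  have far x y (c : R) : 0 <= c -> 0 < x -> 0 < y -> (x + y) ^+ 2 <= (c * (r i + r j)) ^+ 2 ->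
      x + y <= c * (r i + r j).
    by move=> c0 x0 y0; rewrite ler_pXn2r // nnegrE ?mulr_ge0 ?addr_ge0 // ltW.
  case/andP: t01 => t_ge0 t_le1.
  have [ki|ki] := eqVneq k i.
    apply: t0; move: (coord 0) (coord 1); rewrite ki => e0 e1.
    apply/eqP; move: (esym dij) => /eqP.
    have : t * (a j - a i) = 0 /\ t * (b j - b i) = 0 by rewrite /a /b; lra.
    case=> /eqP; rewrite mulf_eq0 => /orP[//|/eqP ea] /eqP; rewrite mulf_eq0 => /orP[//|/eqP eb].
    have -> : a i - a j = 0 by lra.
    have -> : b i - b j = 0 by lra.
    by rewrite expr0n addr0 gt_eqF // exprn_gt0 // addr_gt0.
  have [kj|kj] := eqVneq k j.
    apply: t1; move: (coord 0) (coord 1); rewrite kj => e0 e1.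
    apply/eqP; rewrite eq_sym -subr_eq0; move: (esym dij) => /eqP.
    have : (1 - t) * (a j - a i) = 0 /\ (1 - t) * (b j - b i) = 0 by rewrite /a /b; lra.
    case=> /eqP; rewrite mulf_eq0 => /orP[//|/eqP ea] /eqP; rewrite mulf_eq0 => /orP[//|/eqP eb].
    have -> : a i - a j = 0 by lra.
    have -> : b i - b j = 0 by lra.
    by rewrite expr0n addr0 gt_eqF // exprn_gt0 // addr_gt0.
  have := far _ _ t t_ge0 ri0 rk0; have := far _ _ (1 - t) _ rj0 rk0.
  rewrite subr_ge0 !exprMn -dij => /(_ t_le1) hj hi.
  have {}hi : r i + r k <= t * (r i + r j).
    apply: hi; rewrite eq_sym in ki; apply: le_trans (packing_coord_sep ki) _.
    by rewrite /a /b !coord le_eqVlt; apply/orP; left; apply/eqP; ring.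
  have {}hj : r j + r k <= (1 - t) * (r i + r j).
    apply: hj; rewrite eq_sym in kj; apply: le_trans (packing_coord_sep kj) _.
    by rewrite /a /b !coord le_eqVlt; apply/orP; left; apply/eqP; ring.
  by move: hi hj rk0; rewrite mulrBl mul1r; clear; lra.
- move=> e g /fP[[i j] /andP[/= cij /eqP ee] fe] /fP[[k m] /andP[/= ckm /eqP eg] fg] eNg s t.
  move=> /inoo[s01 s0 s1] /inoo[t01 t0 t1]; rewrite /arc fe fg /= => meet.
  have [[ik jm]|[im jk]|[[]]] := contacts_meet cij ckm s01 t01 meet => //.
    by move: eNg; rewrite ee eg ik jm eqxx.
  by move: eNg; rewrite ee eg im jk finset.setUC eqxx.
Qed.

(** After a rotation and scaling that makes the heights distinct, the contact
    segments and the stress satisfy the hypotheses of the sweep; genericity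
    provides the length condition. *)
Lemma contact_stress_eq0 (hn : (2 <= n)%N) (w : 'I_n -> 'I_n -> R) :
  generic r \/ generic (radii_ratios hn r) ->
  (forall i j, w i j = w j i) ->
  (forall i j, w i j != 0 -> contact p r i j) ->
  (forall i, \sum_j w i j * (p i 0 0 - p j 0 0) = 0) ->
  (forall i, \sum_j w i j * (p i 0 1 - p j 0 1) = 0) ->
  forall i j, w i j = 0.
Proof.
move=> gen wC wcon wa wb.
have len i j : w i j != 0 -> (a i - a j) ^+ 2 + (b i - b j) ^+ 2 = (r i + r j) ^+ 2.
  by move/wcon; rewrite contactE dotp_sub => /andP[_ /eqP].
have wr := stress_balances_radii packing_r_gt0 gen wC len wa wb.
have [|y Hinj] := @generic_height R _ a b.
  move=> i j ea eb; apply: centers_inj; apply/matrixP => k l.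
  by rewrite ord1; case: l => [[|[|//]]] ?; [move: ea | move: eb]; rewrite /a /b;
    congr (_ = _); congr (_ _ _); apply: val_inj.
pose H i := y * a i + b i; pose X i := a i - y * b i.
pose c := Num.sqrt (1 + y ^+ 2).
have y1 : 0 < 1 + y ^+ 2 by rewrite ltr_pwDl // sqr_ge0.
have c0 : 0 < c by rewrite sqrtr_gt0.
have c2 : c ^+ 2 = 1 + y ^+ 2 by rewrite sqr_sqrtr // ltW.
apply: (@planar_stress_eq0 R _ X H w (fun i j => c * (r i + r j)) wC Hinj).
- by move=> i j _; rewrite mulr_gt0 // addr_gt0 // packing_r_gt0.
- move=> i j /len e; rewrite exprMn c2 -e /X /H; ring.
- move=> i; transitivity (- \sum_j w i j * (a i - a j) + y * \sum_j w i j * (b i - b j)).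
    by rewrite -sumrN mulr_sumr -big_split; apply: eq_bigr => j _; rewrite /X /=; ring.
  by rewrite wa wb mulr0 oppr0 addr0.
- move=> i; transitivity (- (y * \sum_j w i j * (a i - a j)) - \sum_j w i j * (b i - b j)).
    by rewrite mulr_sumr -!sumrN -big_split; apply: eq_bigr => j _; rewrite /H /=; ring.
  by rewrite wa wb mulr0 oppr0 addr0.
- move=> i; under eq_bigr do rewrite mulrCA.
  by rewrite -mulr_sumr wr mulr0.
- move=> i j k m s t /wcon cij /wcon ckm s01 t01 eX eH.
  apply: (segments_meet packing_r_gt0 packing_coord_sep (contact_touch cij)
    (contact_touch ckm) s01 t01); apply: (mulfI (lt0r_neq0 y1)).
    transitivity ((X i + s * (X j - X i)) + y * (H i + s * (H j - H i))).
      by rewrite /X /H; ring.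
    by rewrite eX eH /X /H; ring.
  transitivity ((H i + s * (H j - H i)) - y * (X i + s * (X j - X i))).
    by rewrite /X /H; ring.
  by rewrite eX eH /X /H; ring.
Qed.

End Contacts.

(** * Independent linear forms *)

Section IndependentRows.
Variables (K : fieldType) (I J : finType) (M : I -> J -> K).

Let A : 'M[K]_(#|I|, #|J|) := \matrix_(i, j) M (enum_val i) (enum_val j).

Let sum_val (T : finType) (F : T -> K) : \sum_(i < #|T|) F (enum_val i) = \sum_i F i.
Proof. by rewrite [RHS](reindex _ (onW_bij _ (@enum_val_bij T))). Qed.

Definition independent_rows :=
  forall c : I -> K, (forall j, \sum_i c i * M i j = 0) -> forall i, c i = 0.

Lemma independent_row_free : independent_rows -> row_free A.
Proof.
move=> ind; apply: inj_row_free => v vA; apply/rowP => i; rewrite mxE.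
rewrite -(enum_valK i) (ind (fun i => v 0 (enum_rank i))) // => j.
have := congr1 (fun u : 'rV[K]_#|J| => u 0 (enum_rank j)) vA; rewrite !mxE => e.
rewrite -[RHS]e -[LHS]sum_val; apply: eq_bigr => k _.
by rewrite !mxE enum_valK enum_rankK.
Qed.

Lemma independent_rows_leq : independent_rows -> (#|I| <= #|J|)%N.
Proof. by move/independent_row_free => /eqP <-; exact: rank_leq_col. Qed.

Lemma independent_rows_dual : independent_rows ->
  exists B : I -> J -> K, forall i k, \sum_j B k j * M i j = (i == k)%:R.
Proof.
move=> /independent_row_free/row_freeP[B AB].
exists (fun k j => B (enum_rank j) (enum_rank k)) => i k.
have := congr1 (fun C : 'M[K]_#|I| => C (enum_rank i) (enum_rank k)) AB.
rewrite !mxE (inj_eq enum_rank_inj) => e; rewrite -[RHS]e -[LHS]sum_val.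
by apply: eq_bigr => j _; rewrite !mxE !enum_rankK enum_valK mulrC.
Qed.

Lemma independent_rows_ker0 : independent_rows -> #|I| = #|J| ->
  forall x : J -> K, (forall i, \sum_j x j * M i j = 0) -> forall j, x j = 0.
Proof.
move=> /independent_row_free fr IJ x xM j.
have /row_fullP[B BA] : row_full A by rewrite /row_full (eqP fr) IJ.
pose y : 'cV[K]_#|J| := \col_j x (enum_val j).
have Ay : A *m y = 0.
  apply/colP => i; rewrite !mxE -[RHS](xM (enum_val i)) -[RHS]sum_val.
  by apply: eq_bigr => k _; rewrite !mxE mulrC.
have := congr1 (fun u : 'cV[K]_#|J| => u (enum_rank j) 0) (mul1mx y).
by rewrite -BA -mulmxA Ay mulmx0 !mxE enum_rankK.
Qed.

End IndependentRows.

Lemma wide_kernel (K : fieldType) (I J : finType) (M : I -> J -> K) :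
  (#|I| < #|J|)%N ->
  exists x : J -> K, (forall i, \sum_j x j * M i j = 0) /\ exists j, x j != 0.
Proof.
move=> lt; apply: contrapT => none.
have : independent_rows (fun j i => M i j).
  move=> c cM j; apply/eqP/negPn/negP => cj; apply: none.
  by exists c; split=> //; exists j.
by move/independent_rows_leq; rewrite leqNgt lt.
Qed.

Section Functionals.
Variables (K : fieldType) (n : nat) (A : {set 'I_n}) (I : finType).
Variable rho : I -> ('I_n -> 'rV[K]_2) -> K.
Hypothesis rho_lin : forall i c u v,
  rho i (fun k => c *: u k + v k) = c * rho i u + rho i v.
Hypothesis rho_supp : forall i u v, {in A, u =1 v} -> rho i u = rho i v.

Let J : finType := ({k : 'I_n | k \in A} * 'I_2)%type.

Let dlt (q : J) : 'I_n -> 'rV[K]_2 :=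
  fun k => if k == val q.1 then delta_mx 0 q.2 else 0.

Let comb (x : J -> K) : 'I_n -> 'rV[K]_2 := fun k => \sum_q x q *: dlt q k.

Let rho0 i : rho i (fun _ => 0) = 0.
Proof.
have := rho_lin i (-1) (fun _ => 0) (fun _ => 0).
have -> : (fun k : 'I_n => -1 *: 0 + 0 : 'rV[K]_2) = (fun _ => 0).
  by apply/funext => k; rewrite scaler0 addr0.
by rewrite mulN1r addNr.
Qed.

Let rho_comb i x : rho i (comb x) = \sum_q x q * rho i (dlt q).
Proof.
rewrite /comb; elim: (index_enum J) => [|q s IH].
  by rewrite big_nil -[RHS](rho0 i); congr rho; apply/funext => k; rewrite big_nil.
rewrite big_cons -IH -rho_lin; congr rho; apply/funext => k.
by rewrite big_cons.
Qed.

Let comb_coord x k l (kA : k \in A) : comb x k 0 l = x (Sub k kA, l).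
Proof.
rewrite /comb summxE (bigD1 (Sub k kA, l)) //= big1 => [|[k' l'] /= ne].
  by rewrite /dlt /= eqxx !mxE !eqxx mulr1 addr0.
rewrite /dlt mxE /=; case: eqP => [kk|_]; last by rewrite mxE mulr0.
rewrite mxE eqxx /=; case: eqP => [ll|_]; last by rewrite mulr0.
by case/eqP: ne; congr pair => //; apply: val_inj; rewrite /= kk.
Qed.

Let coords (v : 'I_n -> 'rV[K]_2) : J -> K := fun q => v (val q.1) 0 q.2.

Let rho_coords i v : rho i v = \sum_q coords v q * rho i (dlt q).
Proof.
rewrite -rho_comb; apply: rho_supp => k kA; apply/rowP => l.
by rewrite (comb_coord _ _ kA) /coords /=.
Qed.

Let cardJ : #|J| = (2 * #|A|)%N.
Proof. by rewrite card_prod card_sig card_ord mulnC. Qed.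

Definition independent_functionals :=
  forall c : I -> K, (forall v, \sum_i c i * rho i v = 0) -> forall i, c i = 0.

Let independent_matrix : independent_functionals ->
  independent_rows (fun i q => rho i (dlt q)).
Proof.
move=> ind c cM; apply: ind => v.
under eq_bigr do rewrite rho_coords mulr_sumr.
rewrite exchange_big big1 //= => q _.
by under eq_bigr do rewrite mulrCA; rewrite -mulr_sumr cM mulr0.
Qed.

Lemma independent_functionals_leq : independent_functionals -> (#|I| <= 2 * #|A|)%N.
Proof. by move/independent_matrix/independent_rows_leq; rewrite cardJ. Qed.

Lemma independent_functionals_dual : independent_functionals ->
  exists B : I -> 'I_n -> 'rV[K]_2, forall i k, rho i (B k) = (i == k)%:R.
Proof.
move/independent_matrix/independent_rows_dual => [B BP].
by exists (fun k => comb (B k)) => i k; rewrite rho_comb.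
Qed.

Lemma independent_functionals_ker0 : independent_functionals ->
  #|I| = (2 * #|A|)%N ->
  forall v, (forall i, rho i v = 0) -> forall k, k \in A -> v k = 0.
Proof.
move=> /independent_matrix ind; rewrite -cardJ => card v rv k kA.
apply/rowP => l; rewrite mxE.
have := independent_rows_ker0 ind card (x := coords v) _ (Sub k kA, l).
rewrite /coords /=; apply => i; by rewrite -rho_coords.
Qed.

Lemma functional_sum i (s : seq I) (x : I -> K) (B : I -> 'I_n -> 'rV[K]_2) :
  rho i (fun k => \sum_(b <- s) x b *: B b k) = \sum_(b <- s) x b * rho i (B b).
Proof.
elim: s => [|b s IH].
  by rewrite big_nil -[RHS](rho0 i); congr rho; apply/funext => k; rewrite big_nil.
rewrite big_cons -IH -rho_lin; congr rho; apply/funext => k.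
by rewrite big_cons.
Qed.

(** When there are as many independent functionals as dimensions, they are
    coordinates. *)
Lemma independent_functionals_basis : independent_functionals ->
  #|I| = (2 * #|A|)%N ->
  exists B : I -> 'I_n -> 'rV[K]_2,
    forall v k, k \in A -> v k = \sum_i rho i v *: B i k.
Proof.
move=> ind card; have [B BP] := independent_functionals_dual ind.
exists B => v k kA; apply/eqP; rewrite eq_sym -subr_eq0 -oppr_eq0 opprB addrC -scaleN1r.
apply/eqP; apply: (independent_functionals_ker0 ind card
  (v := fun k => -1 *: (\sum_i rho i v *: B i k) + v k)) => // i.
rewrite rho_lin functional_sum mulN1r (bigD1 i) //= BP eqxx mulr1 big1 ?addr0 ?addNr //.
by move=> j ji; rewrite BP eq_sym (negPf ji) mulr0.
Qed.

Lemma few_functionals_kernel : (#|I| < 2 * #|A|)%N ->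
  exists v, (forall i, rho i v = 0) /\ exists k l, v k 0 l != 0.
Proof.
rewrite -cardJ => /(@wide_kernel _ _ _ (fun i q => rho i (dlt q)))[x [xM [[k l] xkl]]].
exists (comb x); split=> [i|]; first by rewrite rho_comb.
exists (val k), l; move: (valP k) xkl => kA; rewrite (comb_coord _ _ kA).
by have -> : Sub (val k) kA = k by apply: val_inj.
Qed.

End Functionals.

(** * Pinned rigidity rows *)

Lemma set2_eq (T : finType) (i j k m : T) :
  ([set i; j] == [set k; m])%SET = ((i == k) && (j == m)) || ((i == m) && (j == k)).
Proof.
apply/eqP/orP => [/setP e|[] /andP[/eqP-> /eqP->] //]; last by rewrite finset.setUC.
have := e m; have := e k; have := e j; have := e i; rewrite !inE !eqxx !orbT /=.
move=> /esym/orP[/eqP ->|/eqP ->]; rewrite !eqxx /=.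
  move=> /esym/orP[/eqP -> _|/eqP -> _ _]; rewrite ?eqxx; last by left.
  by move=> /orP[/eqP ->|/eqP ->]; left; rewrite eqxx.
move=> /esym/orP[/eqP -> _ _|/eqP ->]; rewrite ?eqxx; first by right.
by move=> /orP[/eqP ->|/eqP ->] _; right; rewrite eqxx.
Qed.

Section PairSum.
Variables (R : zmodType) (T : finType) (f : T -> T -> R).

(** Summing over both orientations of [e] avoids choosing an order on its ends. *)
Definition pair_sum (e : {set T}) :=
  \sum_i \sum_j if [set i; j]%SET == e then f i j else 0.

Lemma pair_sum2 k m : k != m -> pair_sum [set k; m] = f k m + f m k.
Proof.
move=> km; have pick x y :
    \sum_i \sum_j (if (i == x) && (j == y) then f i j else 0) = f x y.
  rewrite (bigD1 x) //= (bigD1 y) //= !eqxx /= !big1 ?addr0 // => [i /negPf ix|j /negPf jy].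
    by rewrite big1 // => j _; rewrite ix.
  by rewrite jy.
rewrite -(pick k m) -(pick m k) -big_split; apply: eq_bigr => i _ /=.
rewrite -big_split; apply: eq_bigr => j _ /=; rewrite set2_eq.
have [-> |_] /= := eqVneq i k; last by rewrite add0r.
by rewrite (negPf km) /= orbF addr0.
Qed.

End PairSum.

Section Pinned.
Variable R : realType.


Definition cross (u v : 'rV[R]_2) : R := u 0 0 * v 0 1 - u 0 1 * v 0 0.

Definition quarter_turn (u : 'rV[R]_2) : 'rV[R]_2 := \row_k (if k == 0 then - u 0 1 else u 0 0).

Lemma row2P (u v : 'rV[R]_2) : u 0 0 = v 0 0 -> u 0 1 = v 0 1 -> u = v.
Proof.
move=> e0 e1; apply/rowP => -[[|[|//]] ?]; [move: e0 | move: e1];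
  by congr (_ = _); congr (_ _ _); apply: val_inj.
Qed.

Variables (n : nat) (p : 'I_n -> 'rV[R]_2) (F : {set {set 'I_n}}) (i0 j0 : 'I_n).

Definition strain (i j : 'I_n) (v : 'I_n -> 'rV[R]_2) := dotp (p j - p i) (v j - v i).

Definition dist_preserved (w : 'I_n -> 'rV[R]_2) i j :=
  2 * strain i j w + dotp (w j - w i) (w j - w i) = 0.

(** The rows of the rigidity matrix, one per edge of [F], together with three rows
    that pin the position of [i0] and the direction from [i0] to [j0]. *)
Definition pinned_row (a : {e : {set 'I_n} | e \in F} + option 'I_2)
    (v : 'I_n -> 'rV[R]_2) : R :=
  match a with
  | inl e => pair_sum (fun i j => strain i j v) (val e)
  | inr (Some l) => v i0 0 l
  | inr None => cross (p j0 - p i0) (v j0 - v i0)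
  end.

Lemma strainD i j c (u v : 'I_n -> 'rV[R]_2) :
  strain i j (fun k => c *: u k + v k) = c * strain i j u + strain i j v.
Proof. by rewrite /strain !dotpE !mxE; ring. Qed.

Lemma strainC i j v : strain i j v = strain j i v.
Proof. by rewrite /strain !dotpE !mxE; ring. Qed.

Lemma pinned_row_lin a c (u v : 'I_n -> 'rV[R]_2) :
  pinned_row a (fun k => c *: u k + v k) = c * pinned_row a u + pinned_row a v.
Proof.
case: a => [e|[l|]] /=.
- rewrite /pair_sum mulr_sumr -big_split; apply: eq_bigr => i _ /=.
  rewrite mulr_sumr -big_split; apply: eq_bigr => j _ /=.
  by case: eqP => _; rewrite ?strainD // mulr0 addr0.
- by rewrite !mxE.
- by rewrite /cross !mxE; ring.
Qed.

Lemma pinned_row_edge i j (ijF : [set i; j]%SET \in F) v : i != j ->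
  pinned_row (inl (Sub [set i; j]%SET ijF)) v = 2 * strain i j v.
Proof. by move=> ij; rewrite /= pair_sum2 // strainC mulr2n mulrDl !mul1r. Qed.

Lemma pinned_row_supp (A : {set 'I_n}) : i0 \in A -> j0 \in A ->
  (forall e, e \in F -> e \subset A) ->
  forall a (u v : 'I_n -> 'rV[R]_2), {in A, u =1 v} -> pinned_row a u = pinned_row a v.
Proof.
move=> i0A j0A FA [e|[l|]] u v uv /=; rewrite ?uv //.
apply: eq_bigr => i _; apply: eq_bigr => j _; case: eqP => // ee.
have /fintype.subsetP sub : [set i; j]%SET \subset A by rewrite ee; exact: FA (valP e).
by rewrite /strain !uv // sub // !inE eqxx ?orbT.
Qed.

Lemma card_pinned : #|{: {e : {set 'I_n} | e \in F} + option 'I_2}| = (#|F| + 3)%N.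
Proof. by rewrite card_sum card_sig card_option card_ord. Qed.

End Pinned.

Section ContactRows.
Variables (R : realType) (n : nat) (hn : (2 <= n)%N).
Variables (p : 'I_n -> 'rV[R]_2) (r : 'I_n -> R).
Hypothesis hP : is_packing p r.
Hypothesis gen : generic r \/ generic (radii_ratios hn r).
Variables (F : {set {set 'I_n}}) (i0 j0 : 'I_n).
Hypothesis Fedges : F \subset edges (contact p r).
Hypothesis ij0 : i0 != j0.

Lemma edge_contact i j : [set i; j]%SET \in edges (contact p r) -> contact p r i j.
Proof.
move/edgesP => [k [m [km /eqP]]]; rewrite set2_eq => /orP[] /andP[/eqP -> /eqP ->] //.
by rewrite contact_sym.
Qed.

(** Translations and the rotation about [i0] do not strain edges, so testing a
    dependency on them kills the coefficients of the pins; what is left is a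
    self-stress of the contact graph. *)
Lemma pinned_rows_independent : independent_functionals (pinned_row p (F := F) i0 j0).
Proof.
move=> c cv.
pose w i j := if insub [set i; j]%SET is Some e then c (inl e) else 0.
have wC i j : w i j = w j i by rewrite /w finset.setUC.
have wcon i j : w i j != 0 -> contact p r i j.
  rewrite /w; case: insubP => [e eF _ _|]; last by rewrite eqxx.
  by apply: edge_contact; move/fintype.subsetP: Fedges; apply.
have row_sum v : \sum_a c a * pinned_row p i0 j0 a v =
    \sum_i \sum_j w i j * strain p i j v +
    (c (inr None) * cross (p j0 - p i0) (v j0 - v i0) +
     \sum_l c (inr (Some l)) * v i0 0 l).
  rewrite big_sumType /= [X in _ + X](bigD1 None) //=; congr (_ + (_ + _)); last first.
    rewrite (reindex_omap Some id) /=; last by case.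
    by apply: eq_bigl => l; rewrite eqxx.
  transitivity (\sum_(e : {e : {set 'I_n} | e \in F}) \sum_i \sum_j
     if [set i; j]%SET == val e then c (inl e) * strain p i j v else 0).
    apply: eq_bigr => e _; rewrite mulr_sumr; apply: eq_bigr => i _.
    by rewrite mulr_sumr; apply: eq_bigr => j _; case: eqP; rewrite ?mulr0.
  rewrite exchange_big; apply: eq_bigr => i _; rewrite exchange_big.
  apply: eq_bigr => j _ /=; rewrite /w; case: insubP => [e eF eE|eF].
    rewrite (bigD1 e) //= -eE eqxx big1 ?addr0 // => e' ne.
    by case: eqP => // E; case/eqP: ne; apply: val_inj; exact: esym E.
  rewrite mul0r big1 // => e _; case: eqP => // E.
  by case/negP: eF; rewrite E; exact: valP e.
have strain_const u i j : strain p i j (fun=> u) = 0.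
  by rewrite /strain dotpE !mxE; ring.
have pins0 l : c (inr (Some l)) = 0.
  have := cv (fun=> delta_mx 0 l); rewrite row_sum big1 => [|i _]; last first.
    by rewrite big1 // => j _; rewrite strain_const mulr0.
  have -> : cross (p j0 - p i0) (delta_mx 0 l - delta_mx 0 l : 'rV[R]_2) = 0.
    by rewrite subrr /cross !mxE; ring.
  rewrite mulr0 !add0r (bigD1 l) //= big1 ?addr0 => [|k kl]; last first.
    by rewrite mxE (negPf kl) andbF mulr0.
  by rewrite mxE !eqxx mulr1.
have row_sum' v : \sum_i \sum_j w i j * strain p i j v +
    c (inr None) * cross (p j0 - p i0) (v j0 - v i0) = 0.
  rewrite -[RHS](cv v) row_sum; congr (_ + _).
  by rewrite big1 ?addr0 // => l _; rewrite pins0 mul0r.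
have rot0 : c (inr None) = 0.
  have := row_sum' (fun k => quarter_turn (p k)).
  rewrite big1 => [|i _]; last first.
    by rewrite big1 // => j _; rewrite /strain dotpE !mxE /=; ring.
  rewrite add0r => /eqP; rewrite mulf_eq0 => /orP[/eqP //|].
  have -> : cross (p j0 - p i0) (quarter_turn (p j0) - quarter_turn (p i0)) =
      dotp (p j0 - p i0) (p j0 - p i0).
    by rewrite /cross dotpE !mxE /=; ring.
  rewrite gt_eqF //; case/packing_separated: hP => r0 sep.
  have ji0 : j0 != i0 by rewrite eq_sym.
  apply: lt_le_trans (sep _ _ ji0).
  by rewrite exprn_gt0 // addr_gt0.
have eq_of l : forall i, \sum_j w i j * (p i 0 l - p j 0 l) = 0.
  have orth (x : 'I_n -> R) : \sum_i x i * \sum_j w i j * (p i 0 l - p j 0 l) = 0.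
    apply: (mulfI (lt0r_neq0 (ltr0n R 2))); rewrite mulr0 -sym_sum_sub //.
    have := row_sum' (fun k => x k *: delta_mx 0 l); rewrite rot0 mul0r addr0 => e.
    rewrite -[RHS]e; apply: eq_bigr => i _; apply: eq_bigr => j _; congr (_ * _).
    rewrite /strain /dotp (bigD1 l) //= big1 => [|k kl]; last first.
      by rewrite !mxE (negPf kl) andbF !mulr0 subr0 mulr0.
    by rewrite !mxE !eqxx /=; ring.
  move=> i; pose E k := \sum_j w k j * (p k 0 l - p j 0 l); rewrite -/(E i).
  have : \sum_k (k == i)%:R * E k = 0 := orth _; rewrite (bigD1 i) //= eqxx mul1r.
  by rewrite big1 ?addr0 // => k /negPf ->; rewrite mul0r.
have w0 := contact_stress_eq0 hP gen wC wcon (eq_of 0) (eq_of 1).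
case=> [[e eF]|[l|]]; [|exact: pins0|exact: rot0].
have /edgesP[i [j [_ ee]]] : e \in edges (contact p r) by move/fintype.subsetP: Fedges; apply.
have := w0 i j; rewrite /w; case: insubP => [e' _ E|]; last by rewrite -ee eF.
by move=> <-; congr (c (inl _)); apply: val_inj; rewrite E -ee.
Qed.

End ContactRows.

(** * Trivial flexes, edge counts and infinitesimal rigidity *)

Section TrivialFlexes.
Variable R : realType.

Lemma is_isometryP (f : 'rV[R]_2 -> 'rV[R]_2) : is_isometry f <->
  forall x y, dotp (f x - f y) (f x - f y) = dotp (x - y) (x - y).
Proof.
split=> iso x y; last by rewrite /enorm iso.
have := congr1 (fun z => z ^+ 2) (iso x y).
by rewrite !sqr_sqrtr ?dotp_ge0.
Qed.

(** Rotation by the angle of cosine [c] and sine [s]. *)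
Definition rotate (c s : R) (u : 'rV[R]_2) := c *: u + s *: quarter_turn u.

Lemma rotate0 c s (u : 'rV[R]_2) : rotate c s u 0 0 = c * u 0 0 - s * u 0 1.
Proof. by rewrite !mxE /= mulrN. Qed.

Lemma rotate1 c s (u : 'rV[R]_2) : rotate c s u 0 1 = c * u 0 1 + s * u 0 0.
Proof. by rewrite !mxE. Qed.

Lemma rotate_isometry (o d : 'rV[R]_2) (c s : R) : c ^+ 2 + s ^+ 2 = 1 ->
  is_isometry (fun x => d + rotate c s (x - o)).
Proof.
move=> cs; apply/is_isometryP => x y.
have -> : d + rotate c s (x - o) - (d + rotate c s (y - o)) = rotate c s (x - y).
  by apply: row2P; rewrite /rotate !mxE /=; ring.
rewrite !dotpE !rotate0 !rotate1; set z0 := (x - y) 0 0; set z1 := (x - y) 0 1.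
transitivity ((c ^+ 2 + s ^+ 2) * (z0 * z0 + z1 * z1)); first by ring.
by rewrite cs mul1r.
Qed.

Lemma trivial_flex_rotation n (p : 'I_n -> 'rV[R]_2) (o a : 'rV[R]_2) (b : R) v :
  (forall i, v i = a + b *: quarter_turn (p i - o)) -> trivial_inf_flex p v.
Proof.
move=> vE.
pose g (t : R) x := (o + t *: a) + rotate (cos (b * t)) (sin (b * t)) (x - o).
have gd x i j : is_derive (0 : R) 1 (fun t => g t x i j) ((a + b *: quarter_turn (x - o)) i j).
  have dlin : is_derive (0 : R) 1 (b \*: (id : R -> R)) b.
    by apply: is_derive_eq; rewrite /GRing.scale /= mulr1.
  have dcos : is_derive (0 : R) 1 (cos \o (b \*: (id : R -> R))) 0.
    by apply: is_derive_eq; rewrite /= /GRing.scale /= mulr0 sin0 oppr0 mul0r.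
  have dsin : is_derive (0 : R) 1 (sin \o (b \*: (id : R -> R))) b.
    by apply: is_derive_eq; rewrite /= /GRing.scale /= mulr0 cos0 mul1r.
  have -> : (fun t => g t x i j) = cst (o i j) + (a i j) \*: (id : R -> R) +
      ((x - o) i j \*: (cos \o (b \*: (id : R -> R))) +
       quarter_turn (x - o) i j \*: (sin \o (b \*: (id : R -> R)))).
    apply/funext => t; rewrite /g /rotate !fctE /= !mxE /GRing.scale /=.
    by case: ifP => _; ring.
  have did := @is_derive_id R R 0 1; have dcst := @is_derive_cst R R R (o i j) 0 1.
  apply: (is_derive_eq (is_deriveD (is_deriveD dcst (is_deriveZ (a i j) did))
    (is_deriveD (is_deriveZ ((x - o) i j) dcos)
       (is_deriveZ (quarter_turn (x - o) i j) dsin)))).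
  rewrite /GRing.scale /= !mxE /=.
  by case: ifP => _; ring.
have gd' x : derivable (fun t => g t x) 0 1.
  by apply/derivable_mxP => i j; have [] := gd x i j.
exists g; split=> //.
- by move=> t; apply: rotate_isometry; exact: cos2Dsin2.
- move=> x; rewrite /g scale0r mulr0 cos0 sin0 /rotate scale1r scale0r !addr0.
  by rewrite addrC subrK.
- move=> i; rewrite derive1E derive_mx // vE; apply/matrixP => k l; rewrite [RHS]mxE.
  by have [_ ->] := gd (p i) k l.
Qed.

(** The derivative V of a family of isometries of the whole plane satisfies
    (x - y) . (V x - V y) = 0 for all x and y; testing y on a frame at [o] shows
    that V is affine with skew linear part.  The points [p i] alone would not
    suffice, since they may be collinear. *)
Lemma trivial_flexE n (p : 'I_n -> 'rV[R]_2) v (o : 'rV[R]_2) :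
  trivial_inf_flex p v ->
  exists a b, forall i, v i = a + b *: quarter_turn (p i - o).
Proof.
case=> g [iso g0 gd vE].
pose V x := 'D_1 (fun t => g t x) 0.
have dV x k : is_derive (0 : R) 1 (fun t => g t x 0 k) (V x 0 k).
  apply: DeriveDef; first by have /derivable_mxP := gd x; apply.
  by rewrite /V derive_mx // mxE.
have orth x y : dotp (x - y) (V x - V y) = 0.
  pose f k := (fun t => g t x 0 k) - (fun t => g t y 0 k).
  have df k : is_derive (0 : R) 1 (f k) (V x 0 k - V y 0 k) by apply: is_deriveB.
  have f0 k : f k 0 = x 0 k - y 0 k by rewrite /f !fctE !g0.
  have dq : is_derive (0 : R) 1 (f 0 * f 0 + f 1 * f 1) (2 * dotp (x - y) (V x - V y)).
    apply: (is_derive_eq (is_deriveD (is_deriveM (df 0) (df 0)) (is_deriveM (df 1) (df 1)))).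
    rewrite !f0 /GRing.scale /=; move: (V x) (V y) => A B.
    by rewrite dotpE !mxE; ring.
  have cq : f 0 * f 0 + f 1 * f 1 = cst (dotp (x - y) (x - y)).
    apply/funext => t; rewrite -((is_isometryP (g t)).1 (iso t)) dotpE !mxE.
    by [].
  have := @derive_val _ _ _ _ _ _ _ dq; rewrite cq derive_cst => /esym/eqP.
  by rewrite mulf_eq0 pnatr_eq0 => /eqP.
pose e0 : 'rV[R]_2 := delta_mx 0 0; pose e1 : 'rV[R]_2 := delta_mx 0 1.
exists (V o), (V (o + e0) 0 1 - V o 0 1) => i.
rewrite vE derive1E -/(V (p i)).
have := orth (p i) o; have := orth (o + e0) o; have := orth (o + e1) o.
have := orth (p i) (o + e0); have := orth (p i) (o + e1); have := orth (o + e0) (o + e1).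
move: (V (p i)) (V o) (V (o + e0)) (V (o + e1)) => A B C D.
rewrite !dotpE !mxE /= => h1 h2 h3 h4 h5 h6.
have c0 : C 0 0 = B 0 0 by lra.
have d1 : D 0 1 = B 0 1 by lra.
have d0 : D 0 0 = B 0 0 - (C 0 1 - B 0 1) by move: h1; rewrite c0 d1; lra.
move: h2 h3; rewrite c0 d1 d0 => h2 h3.
by apply: row2P; rewrite !mxE /=; lra.
Qed.

End TrivialFlexes.

Section Counting.
Variables (R : realType) (n : nat) (hn : (2 <= n)%N).
Variables (p : 'I_n -> 'rV[R]_2) (r : 'I_n -> R).
Hypothesis hP : is_packing p r.
Hypothesis gen : generic r \/ generic (radii_ratios hn r).

Lemma contact_laman_sparse : laman_sparse (contact p r).
Proof.
move=> A F FE FA /card_gt1P[i0 [j0 [i0A j0A ij]]].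
have ind := pinned_rows_independent hP gen FE ij.
have := independent_functionals_leq (pinned_row_lin p i0 j0)
  (pinned_row_supp p i0A j0A FA) ind.
rewrite card_pinned => le; rewrite -(leq_add2r 3) subnK //.
by apply: leq_trans le; rewrite leq_addl.
Qed.

Lemma contact_edges_leq : (#|edges (contact p r)| <= 2 * n - 3)%N.
Proof.
have := @contact_laman_sparse [set: 'I_n]%SET (edges (contact p r)) (subxx _).
by rewrite cardsT card_ord; apply=> // e _; apply/fintype.subsetP => x; rewrite inE.
Qed.

Lemma all_edges_sub (e : {set 'I_n}) : e \in edges (contact p r) -> e \subset [set: 'I_n]%SET.
Proof. by move=> _; apply/fintype.subsetP => x; rewrite inE. Qed.

Variables (i0 j0 : 'I_n).
Hypothesis ij0 : i0 != j0.

Let row := pinned_row p (F := edges (contact p r)) i0 j0.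

Lemma pinned_rows_full_independent : independent_functionals row.
Proof. exact (pinned_rows_independent hP gen (subxx (edges (contact p r))) ij0). Qed.

Lemma pinned_row_supp_all a (u v : 'I_n -> 'rV[R]_2) :
  {in [set: 'I_n]%SET, u =1 v} -> row a u = row a v.
Proof. by apply: pinned_row_supp; rewrite ?inE //; exact: all_edges_sub. Qed.

Lemma pinned_row_flex0 v : inf_flex p r v -> forall e, row (inl e) v = 0.
Proof.
move=> fv [e eE]; have [i [j [ij ee]]] := edgesP eE.
subst e; rewrite /row pinned_row_edge ?(contact_irr ij) // /strain fv ?mulr0 //.
Qed.

Lemma pinned_ker0 : #|edges (contact p r)| = (2 * n - 3)%N ->
  forall v, (forall a, row a v = 0) -> forall k, v k = 0.
Proof.
move=> card v rv k.
apply: (independent_functionals_ker0 (pinned_row_lin p i0 j0) pinned_row_supp_all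
  pinned_rows_full_independent _ rv (k := k)); last by rewrite inE.
by rewrite card_pinned card cardsT card_ord; move: hn; lia.
Qed.

Lemma pin_base_gt0 : 0 < dotp (p j0 - p i0) (p j0 - p i0).
Proof.
case/packing_separated: hP => r0 sep; have ji0 : j0 != i0 by rewrite eq_sym.
by apply: lt_le_trans (sep _ _ ji0); rewrite exprn_gt0 // addr_gt0.
Qed.

Lemma strain_rotation (o a : 'rV[R]_2) (b : R) i j :
  strain p i j (fun k => a + b *: quarter_turn (p k - o)) = 0.
Proof. by rewrite /strain dotpE !mxE /=; ring. Qed.

(** Subtract the trivial flex with the same pinned coordinates: the difference is
    in the kernel of all rows. *)
Lemma tight_inf_rigid : #|edges (contact p r)| = (2 * n - 3)%N -> inf_rigid p r.
Proof.
move=> card v fv.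
pose b := cross (p j0 - p i0) (v j0 - v i0) / dotp (p j0 - p i0) (p j0 - p i0).
pose t k := v i0 + b *: quarter_turn (p k - p i0).
apply: (@trivial_flex_rotation _ _ _ (p i0) (v i0) b) => i.
have d0 := pin_base_gt0.
suff : (fun k => -1 *: t k + v k) i = 0.
  by rewrite scaleN1r addrC => /eqP; rewrite subr_eq0 => /eqP.
apply: (pinned_ker0 card (v := fun k => -1 *: t k + v k)) => a; rewrite /row pinned_row_lin mulN1r.
case: a => [e|[l|]].
- rewrite -!/row (pinned_row_flex0 fv) addr0 (@pinned_row_flex0 t) ?oppr0 // => i' j' _.
  exact: strain_rotation.
- by rewrite /= /t subrr !mxE /=; case: ifP => _; ring.
- rewrite /= /t /cross !mxE /=.
  rewrite /b dotpE /cross !mxE; field.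
  by move: d0; rewrite dotpE !mxE => /lt0r_neq0.
Qed.

(** A velocity in the kernel of all rows is an infinitesimal flex, and a trivial
    flex that satisfies the pins is 0. *)
Lemma loose_inf_flexible : (#|edges (contact p r)| < 2 * n - 3)%N -> inf_flexible p r.
Proof.
move=> card rig.
have [|v [rv [k [l vkl]]]] := few_functionals_kernel (A := [set: 'I_n]%SET)
    (pinned_row_lin p (F := edges (contact p r)) i0 j0).
  by rewrite card_pinned cardsT card_ord addnC -ltn_subRL.
have fv : inf_flex p r v.
  move=> i j ij; have eE := contact_edge ij.
  have := rv (inl (Sub [set i; j]%SET eE)); rewrite pinned_row_edge ?(contact_irr ij) //.
  by move/eqP; rewrite mulf_eq0 pnatr_eq0 => /eqP.
have [a [b vE]] := trivial_flexE (p i0) (rig _ fv).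
have d0 := pin_base_gt0.
have a0 : a = 0.
  have := vE i0; rewrite subrr => va; apply: row2P.
    by have := rv (inr (Some 0)); rewrite /= va !mxE /= oppr0 mulr0 addr0.
  by have := rv (inr (Some 1)); rewrite /= va !mxE /= mulr0 addr0.
have b0 : b = 0.
  have := rv (inr None); rewrite /= !vE a0 !add0r subrr.
  have -> : cross (p j0 - p i0) (b *: quarter_turn (p j0 - p i0) - b *: quarter_turn 0) =
     b * dotp (p j0 - p i0) (p j0 - p i0) by rewrite /cross dotpE !mxE /=; ring.
  by move/eqP; rewrite mulf_eq0 (gt_eqF d0) orbF => /eqP.
by move: vkl; rewrite vE a0 b0 scale0r addr0 mxE eqxx.
Qed.

End Counting.

(** * Rigidity with 2n - 3 contacts *)

Section WithinContinuity.
Variables (R : realType) (A : set R).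

Lemma within_cst (c : R) : {within A, continuous (fun=> c : R)}.
Proof. by move=> x; exact: cvg_cst. Qed.

Lemma withinD (f g : R -> R) : {within A, continuous f} -> {within A, continuous g} ->
  {within A, continuous (fun t => f t + g t)}.
Proof. by move=> cf cg x; apply: cvgD; [exact: cf | exact: cg]. Qed.

Lemma withinN (f : R -> R) : {within A, continuous f} ->
  {within A, continuous (fun t => - f t)}.
Proof. by move=> cf x; apply: cvgN; exact: cf. Qed.

Lemma withinM (f g : R -> R) : {within A, continuous f} -> {within A, continuous g} ->
  {within A, continuous (fun t => f t * g t)}.
Proof. by move=> cf cg x; apply: cvgM; [exact: cf | exact: cg]. Qed.

Lemma within_sum (I : Type) (s : seq I) (f : I -> R -> R) :
  (forall i, {within A, continuous (f i)}) ->
  {within A, continuous (fun t => \sum_(i <- s) f i t)}.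
Proof.
move=> cf; elim: s => [|i s IH].
  by under eq_fun do rewrite big_nil; exact: within_cst.
by under eq_fun do rewrite big_cons; exact: withinD.
Qed.

Lemma within_coord (q : R -> 'rV[R]_2) k : {within A, continuous q} ->
  {within A, continuous (fun t => q t 0 k)}.
Proof.
move=> cq x.
apply: (@continuous_comp (subspace A) 'rV[R]_2 R q (fun y : 'rV[R]_2 => y 0 k) x).
  exact: cq.
exact: coord_continuous.
Qed.

End WithinContinuity.

(** The inequality keeps [f] out of the open interval from 0 to 1/K, while a
    continuous function cannot jump over it. *)
Lemma gap_zero (R : realType) (f : R -> R) (K : R) :
  {within `[0, 1], continuous f} -> f 0 = 0 ->
  (forall t, t \in `[0, 1] -> 0 <= f t /\ f t <= K * f t ^+ 2) ->
  forall t, t \in `[0, 1] -> f t = 0.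
Proof.
move=> cf f0 fK t t01; apply/eqP/negPn/negP => ft.
have [t0 t1] : 0 <= t /\ t <= 1 by move: t01; rewrite in_itv => /andP.
have [ft0 ftK] := fK t t01.
have {}ft0 : 0 < f t by rewrite lt_def ft.
have K0 : 0 < K.
  by rewrite ltNge; apply/negP => K0; have := sqr_ge0 (f t); nra.
(* a value that the inequality forbids, below 1/K *)
pose v := Num.min (f t) (1 / (2 * K)).
have v0 : 0 < v by rewrite lt_min ft0 divr_gt0 // mulr_gt0.
have [||c c0t fc] := @IVT R f 0 t v t0.
- apply: continuous_subspaceW cf => x /=; rewrite !in_itv /= => /andP[-> xt].
  exact: le_trans xt t1.
- rewrite f0 /Num.min /Num.max ft0 ltW //= /v ge_min lexx //.
have c01 : c \in `[0, 1].
  by move: c0t; rewrite !in_itv /= => /andP[-> ct]; exact: le_trans ct t1.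
have [_] := fK c c01; rewrite fc.
have vK : v * (2 * K) <= 1.
  by rewrite -ler_pdivlMr ?mulr_gt0 // ge_min lexx orbT.
by rewrite expr2; nra.
Qed.

Section Rigid.
Variables (R : realType) (n : nat) (hn : (2 <= n)%N).
Variables (p : 'I_n -> 'rV[R]_2) (r : 'I_n -> R).
Hypothesis hP : is_packing p r.
Hypothesis gen : generic r \/ generic (radii_ratios hn r).
Hypothesis tight : #|edges (contact p r)| = (2 * n - 3)%N.
Variables (i0 j0 : 'I_n).
Hypothesis ij0 : contact p r i0 j0.

Let ne0 : i0 != j0 := contact_irr ij0.
Let row := pinned_row p (F := edges (contact p r)) i0 j0.

Lemma pinned_expansion : exists B : _ -> 'I_n -> 'rV[R]_2,
  forall v k, v k = \sum_a row a v *: B a k.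
Proof.
have [|B BE] := independent_functionals_basis (pinned_row_lin p i0 j0)
  (@pinned_row_supp_all _ _ p r i0 j0) (pinned_rows_full_independent hP gen ne0).
  by rewrite card_pinned tight cardsT card_ord; move: hn; lia.
by exists B => v k; apply: BE; rewrite inE.
Qed.

Definition energy (w : 'I_n -> 'rV[R]_2) := \sum_k dotp (w k) (w k).

Lemma energy_ge0 w : 0 <= energy w.
Proof. by apply: sumr_ge0 => k _; exact: dotp_ge0. Qed.

Lemma energy_eq0 w : energy w = 0 -> forall k, w k = 0.
Proof.
move=> e k; have : dotp (w k) (w k) == 0.
  move/eqP: e; rewrite psumr_eq0 => [/allP/(_ k)|i _]; last exact: dotp_ge0.
  by rewrite mem_index_enum; apply.
rewrite dotpE -!expr2 paddr_eq0 ?sqr_ge0 // !sqrf_eq0 => /andP[/eqP e0 /eqP e1].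
by apply: row2P; rewrite mxE.
Qed.

Definition preserves_contacts (w : 'I_n -> 'rV[R]_2) := forall i j,
  contact p r i j -> dist_preserved p w i j.

(** Expand w in the basis dual to the rows: the pins vanish and the row of an edge
    is minus the square of the relative displacement, hence at most 4 times the
    energy. *)
Lemma pinned_energy_gap : exists K, forall w : 'I_n -> 'rV[R]_2,
  preserves_contacts w -> w i0 = 0 -> w j0 = 0 -> energy w <= K * energy w ^+ 2.
Proof.
have [B BE] := pinned_expansion.
pose C k l := \sum_a 4 * `|B a k 0 l|.
exists (\sum_k (C k 0 ^+ 2 + C k 1 ^+ 2)) => w wc wi wj.
set E := energy w.
have E0 : 0 <= E := energy_ge0 w.
have wE k : dotp (w k) (w k) <= E.
  by rewrite /E /energy (bigD1 k) //= lerDl sumr_ge0 // => i _; exact: dotp_ge0.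
have rowE a : `|row a w| <= 4 * E.
  case: a => [[e eE]|[l|]].
  - have [i [j [ij ee]]] := edgesP eE; subst e.
    rewrite /row pinned_row_edge ?(contact_irr ij) //.
    have -> : 2 * strain p i j w = - dotp (w j - w i) (w j - w i).
      by have := wc i j ij; rewrite /dist_preserved; lra.
    rewrite normrN ger0_norm ?dotp_ge0 //; have := wE i; have := wE j.
    rewrite !dotpE !mxE.
    have := sqr_ge0 (w j 0 0 + w i 0 0); have := sqr_ge0 (w j 0 1 + w i 0 1).
    by rewrite !expr2; lra.
  - by rewrite /= wi mxE normr0 mulr_ge0.
  - by rewrite /= wi wj /cross !mxE subrr !mulr0 subrr normr0 mulr_ge0.
have coordE k l : w k 0 l ^+ 2 <= C k l ^+ 2 * E ^+ 2.
  rewrite -exprMn -real_normK ?num_real // lerXn2r ?nnegrE //.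
    by rewrite mulr_ge0 // sumr_ge0 // => a _; rewrite mulr_ge0.
  rewrite {1}BE summxE; apply: le_trans (ler_norm_sum _ _ _) _.
  rewrite /C mulr_suml; apply: ler_sum => a _.
  rewrite mxE normrM mulrAC; apply: ler_wpM2r => //.
rewrite {1}/E /energy mulr_suml; apply: ler_sum => k _.
by rewrite dotpE -!expr2 mulrDl lerD.
Qed.

(** Undo the motion of the contact between [i0] and [j0] by a rotation with
    continuous cosine and sine; the remaining displacement [w] is pinned and
    preserves contacts, and starts at 0. *)
Lemma tight_rigid : rigid p r.
Proof.
move=> q [cq q0 fl].
have dist_contact t i j : t \in `[0, 1] -> contact p r i j ->
    dotp (q t i - q t j) (q t i - q t j) = dotp (p i - p j) (p i - p j).
  move=> t01 ij; have [pq keep] := fl t t01.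
  have := keep i j ij; rewrite (contactE pq) => /andP[_ /eqP ->].
  by move: ij; rewrite (contactE hP) => /andP[_ /eqP ->].
pose d := p j0 - p i0; pose D t := q t j0 - q t i0.
have d0 : 0 < dotp d d := pin_base_gt0 hP ne0.
pose c t := dotp d (D t) / dotp d d; pose s t := cross d (D t) / dotp d d.
have DD t : t \in `[0, 1] -> dotp (D t) (D t) = dotp d d.
  move=> t01; have := dist_contact t i0 j0 t01 ij0.
  by rewrite /D /d !dotpE !mxE; lra.
have cs t : t \in `[0, 1] -> c t ^+ 2 + s t ^+ 2 = 1.
  move=> t01; have -> : c t ^+ 2 + s t ^+ 2 = dotp (D t) (D t) / dotp d d.
    have : dotp d (D t) ^+ 2 + cross d (D t) ^+ 2 = dotp d d * dotp (D t) (D t).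
      by rewrite /cross !dotpE; ring.
    by rewrite /c /s !expr_div_n -mulrDl => ->; field; rewrite gt_eqF.
  by rewrite DD // divff // gt_eqF.
have rotd t : rotate (c t) (s t) d = D t.
  have cK : c t * dotp d d = dotp d (D t) by rewrite divfK // gt_eqF.
  have sK : s t * dotp d d = cross d (D t) by rewrite divfK // gt_eqF.
  apply: row2P; apply: (mulIf (lt0r_neq0 d0)); rewrite ?rotate0 ?rotate1.
    by rewrite mulrBl ![_ * d 0 _ * _]mulrAC cK sK !dotpE /cross; ring.
  by rewrite mulrDl ![_ * d 0 _ * _]mulrAC cK sK !dotpE /cross; ring.
pose w t k := rotate (c t) (- s t) (q t k - q t i0) - (p k - p i0).
have rot_inv t u : t \in `[0, 1] -> rotate (c t) (- s t) (rotate (c t) (s t) u) = u.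
  move=> t01; have e := cs t t01.
  apply: row2P; rewrite !(rotate0, rotate1).
    by transitivity ((c t ^+ 2 + s t ^+ 2) * u 0 0); [ring | rewrite e mul1r].
  by transitivity ((c t ^+ 2 + s t ^+ 2) * u 0 1); [ring | rewrite e mul1r].
have rot_inv' t u : t \in `[0, 1] -> rotate (c t) (s t) (rotate (c t) (- s t) u) = u.
  move=> t01; have e := cs t t01.
  apply: row2P; rewrite !(rotate0, rotate1).
    by transitivity ((c t ^+ 2 + s t ^+ 2) * u 0 0); [ring | rewrite e mul1r].
  by transitivity ((c t ^+ 2 + s t ^+ 2) * u 0 1); [ring | rewrite e mul1r].
have ccoord i l : {within `[0, 1], continuous (fun t => q t i 0 l)}.
  exact/within_coord/cq.
have cD l : {within `[0, 1], continuous (fun t => D t 0 l)}.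
  have -> : (fun t => D t 0 l) = (fun t => q t j0 0 l - q t i0 0 l).
    by apply/funext => u; rewrite /D !mxE.
  by apply: withinD; [|apply: withinN].
have cc : {within `[0, 1], continuous c}.
  rewrite /c; apply: withinM; last exact: within_cst.
  have -> : (fun t => dotp d (D t)) = (fun t => d 0 0 * D t 0 0 + d 0 1 * D t 0 1).
    by apply/funext => u; rewrite dotpE.
  by apply: withinD; apply: withinM => //; exact: within_cst.
have csn : {within `[0, 1], continuous s}.
  rewrite /s; apply: withinM; last exact: within_cst.
  rewrite /cross; apply: withinD; last apply: withinN.
    by apply: withinM => //; exact: within_cst.
  by apply: withinM => //; exact: within_cst.
have w0 t k : t \in `[0, 1] -> w t k = 0.
  have [K gap] := pinned_energy_gap.
  have cw i l : {within `[0, 1], continuous (fun t => w t i 0 l)}.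
    have cdiff l' : {within `[0, 1], continuous (fun t => q t i 0 l' - q t i0 0 l')}.
      by apply: withinD; [|apply: withinN].
    have [l0|l1] : l = 0 \/ l = 1.
      by case: l => [[|[|//]]] ?; [left | right]; apply: val_inj.
      have -> : (fun t => w t i 0 l) = (fun t => c t * (q t i 0 0 - q t i0 0 0) +
          s t * (q t i 0 1 - q t i0 0 1) + - (p i - p i0) 0 l).
        by apply/funext => u; rewrite l0 /w mxE rotate0 !mxE; ring.
      by apply: withinD; [apply: withinD; exact: withinM | exact: within_cst].
    have -> : (fun t => w t i 0 l) = (fun t => c t * (q t i 0 1 - q t i0 0 1) +
        - (s t * (q t i 0 0 - q t i0 0 0)) + - (p i - p i0) 0 l).
      by apply/funext => u; rewrite l1 /w mxE rotate1 !mxE; ring.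
    apply: withinD; last exact: within_cst.
    by apply: withinD; [|apply: withinN]; exact: withinM.
  move=> t01; apply: energy_eq0.
  apply: (@gap_zero _ (fun t => energy (w t)) K) => //.
  - apply: within_sum => i.
    have -> : (fun t => dotp (w t i) (w t i)) =
        (fun t => w t i 0 0 * w t i 0 0 + w t i 0 1 * w t i 0 1).
      by apply/funext => u; rewrite dotpE.
    by apply: withinD; apply: withinM.
  - rewrite /energy big1 // => i _; have -> : w 0 i = 0.
      rewrite /w !q0 /c /s /D !q0 -/d.
      have -> : cross d d = 0 by rewrite /cross; ring.
      rewrite mul0r oppr0 divff ?gt_eqF // /rotate scale1r scale0r addr0 subrr //.
    by rewrite dotpE !mxE; ring.
  - move=> u u01; split; first exact: energy_ge0.
    have eu := cs u u01.
    apply: gap.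
    + move=> i j ij; have := dist_contact u i j u01 ij.
      rewrite /dist_preserved /strain /w.
      set Q := q u i0; set y := q u i - q u j; set x := p i - p j.
      have -> : p j - p i = - x by rewrite /x opprB.
      have -> : rotate (c u) (- s u) (q u j - Q) - (p j - p i0) -
         (rotate (c u) (- s u) (q u i - Q) - (p i - p i0)) =
         x - rotate (c u) (- s u) y.
        by apply: row2P; rewrite /rotate /x /y !mxE /=; ring.
      have : dotp (rotate (c u) (- s u) y) (rotate (c u) (- s u) y) = dotp y y.
        rewrite !dotpE !rotate0 !rotate1.
        transitivity ((c u ^+ 2 + s u ^+ 2) * (y 0 0 * y 0 0 + y 0 1 * y 0 1)).
          by ring.
        by rewrite eu mul1r.
      move: (rotate _ _ y) => Y; clearbody x y => YY yx.
      by move: YY yx; rewrite !dotpE !mxE => YY yx; lra.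
    + by rewrite /w !subrr /rotate; apply: row2P; rewrite !mxE /=; ring.
    + by rewrite /w -/(D u) -rotd rot_inv // subrr.
pose g t x := q t i0 + rotate (c t) (s t) (x - p i0).
exists g; last first.
  move=> t i t01; rewrite /g; have /eqP := w0 t i t01.
  rewrite /w subr_eq0 => /eqP <-; rewrite rot_inv' //.
  by rewrite addrC subrK.
split.
- by move=> t t01; apply: rotate_isometry; exact: cs.
- move=> x; rewrite /g /c /s /D !q0 -/d.
  have -> : cross d d = 0 by rewrite /cross; ring.
  by rewrite mul0r divff ?gt_eqF // /rotate scale1r scale0r addr0 addrC subrK.
- move=> x y; apply: cvgD; first exact: cq.
  by apply: cvgD; apply: cvgZr_tmp; [exact: cc | exact: csn].
Qed.

End Rigid.

(** * A pinned motion with fewer contacts *)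

Section PerturbedIdentity.
Variables (R : realType) (V : completeNormedModType R).

(** A local inverse of the perturbation of the identity by [Q], along the line
    through [u]: y t is the fixed point of Y |-> t u - Q Y, which is a contraction
    of ratio 1/2 on the ball of radius 1 / (4 K). *)
Lemma perturbed_identity (Q : V -> V) (K : R) (u : V) : 0 < K -> `|u| <= 1 ->
  Q 0 = 0 -> (forall Y Z, `|Q Y - Q Z| <= K * (`|Y| + `|Z|) * `|Y - Z|) ->
  exists2 d, 0 < d & exists y : R -> V, [/\ y 0 = 0,
    forall t, `|t| <= d -> y t + Q (y t) = t *: u &
    forall s t, `|s| <= d -> `|t| <= d -> `|y s - y t| <= 2 * `|s - t|].
Proof.
move=> K0 u1 Q0 QK; pose rho := 1 / (4 * K).
have rho0 : 0 < rho by rewrite divr_gt0 // mulr_gt0.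
have Krho : K * rho = 1 / 4 by rewrite /rho; field; rewrite gt_eqF.
pose U := closed_ball (0 : V) rho.
have inU Y : U Y <-> `|Y| <= rho.
  by rewrite /U closed_ballE // /closed_ball_ /= sub0r normrN.
have half Y Z : U Y -> U Z -> `|Q Y - Q Z| <= 1 / 2 * `|Y - Z|.
  move=> /inU hY /inU hZ; apply: le_trans (QK Y Z) _; apply: ler_wpM2r => //.
  have : K * (`|Y| + `|Z|) <= K * (rho + rho) by rewrite ler_pM2l // lerD.
  by rewrite [K * (rho + rho)]mulrDr Krho; lra.
have U0 : U 0 by apply/inU; rewrite normr0 ltW.
have norm_tu (t : R) : `|t *: u| <= `|t| by rewrite normrZ ler_piMr.
have fixed t : `|t| <= rho / 2 -> exists2 Y, U Y & Y = t *: u - Q Y.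
  move=> ht.
  have stab : {homo (fun Y => t *: u - Q Y) : Y / U Y >-> U Y}.
    move=> Y UY; apply/inU; apply: le_trans (ler_normB _ _) _.
    have := half Y 0 UY U0; rewrite Q0 !subr0 => hQ.
    by have /inU := UY; have := norm_tu t; lra.
  apply: (@banach_fixed_point R V U (mkfun_fun stab)); last by exists 0.
    have h0 : 0 <= 1 / 2 :> R by rewrite divr_ge0.
    exists (NngNum h0); split=> /=; first by lra.
    move=> [Y Z] /= [UY UZ].
    have -> : mkfun_fun stab Y - mkfun_fun stab Z = Q Z - Q Y.
      by rewrite /mkfun_fun /mkfun /= opprB addrC subrKA.
    by rewrite distrC; exact: half.
  exact: closed_ball_closed.
pose y t := if pselect (`|t| <= rho / 2) is left h then s2val (cid2 (fixed t h)) else 0.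
have yP t : `|t| <= rho / 2 -> U (y t) /\ y t = t *: u - Q (y t).
  by move=> ht; rewrite /y; case: pselect => // h; case: cid2 => Y /=.
have lip s t : `|s| <= rho / 2 -> `|t| <= rho / 2 -> `|y s - y t| <= 2 * `|s - t|.
  move=> /yP[Us es] /yP[Ut et].
  have : `|y s - y t| <= `|s - t| + 1 / 2 * `|y s - y t|.
    have e : y s - y t = (s - t) *: u - (Q (y s) - Q (y t)).
      by rewrite {1}es {1}et scalerBl !opprB addrACA [RHS]addrACA [- _ + _]addrC.
    rewrite {1}e; apply: le_trans (ler_normB _ _) _.
    by apply: lerD; [exact: norm_tu | exact: half].
  by lra.
exists (rho / 2); first by rewrite divr_gt0.
exists y; split=> //.
- have [|Uy ey] := yP 0; first by rewrite normr0 divr_ge0 // ltW.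
  have := half _ _ Uy U0; rewrite Q0 !subr0 => h.
  have e : `|y 0| = `|Q (y 0)| by rewrite {1}ey scale0r sub0r normrN.
  by apply/eqP; rewrite -normr_le0; move: h; rewrite -e; lra.
- by move=> t /yP[_ {1}->]; rewrite subrK.
Qed.

End PerturbedIdentity.

HB.instance Definition _ (R : realType) (m n : nat) := Complete.on 'M[R]_(m, n).

Lemma rV_norm_le (R : realType) N (Y : 'rV[R]_N) (c : R) : 0 <= c ->
  (forall k, `|Y 0 k| <= c) -> `|Y| <= c.
Proof.
move=> c0 Yc; rewrite [leLHS]/Num.Def.normr /= mx_normrE; apply: bigmax_le => // -[i k] _ /=.
by rewrite ord1.
Qed.

Lemma rV_coord_le (R : realType) N (Y : 'rV[R]_N) k : `|Y 0 k| <= `|Y|.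
Proof.
by rewrite [leRHS]/Num.Def.normr /= mx_normrE; exact: (le_bigmax _ _ (0, k)).
Qed.


Section PinnedMotion.
Variables (R : realType) (n : nat) (hn : (2 <= n)%N).
Variables (p : 'I_n -> 'rV[R]_2) (r : 'I_n -> R).
Hypothesis hP : is_packing p r.
Hypothesis gen : generic r \/ generic (radii_ratios hn r).
Hypothesis loose : (#|edges (contact p r)| < 2 * n - 3)%N.
Variables (i0 j0 : 'I_n).
Hypothesis ne0 : i0 != j0.

Let row := pinned_row p (F := edges (contact p r)) i0 j0.

(** The rows together with one coordinate of a center, the future parameter of the
    motion. *)
Definition extended_row (k0 : 'I_n) (l0 : 'I_2) a (v : 'I_n -> 'rV[R]_2) : R :=
  if a is Some b then row b v else v k0 0 l0.

Lemma extended_row_lin k0 l0 a c (u1 u2 : 'I_n -> 'rV[R]_2) :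
  extended_row k0 l0 a (fun k => c *: u1 k + u2 k) =
  c * extended_row k0 l0 a u1 + extended_row k0 l0 a u2.
Proof. by case: a => [a|] /=; [exact: pinned_row_lin | rewrite !mxE]. Qed.

(** There are fewer rows than dimensions, so some nonzero velocity is in the kernel
    of all rows; a coordinate at which it does not vanish is independent of them. *)
Lemma extended_dual : exists k0 l0 (B : option _ -> 'I_n -> 'rV[R]_2),
  forall a b, extended_row k0 l0 a (B b) = (a == b)%:R.
Proof.
have [|v [rv [k0 [l0 vkl]]]] := few_functionals_kernel (A := [set: 'I_n]%SET)
    (pinned_row_lin p (F := edges (contact p r)) i0 j0).
  by rewrite card_pinned cardsT card_ord addnC -ltn_subRL.
exists k0, l0.
have supp a (u1 u2 : 'I_n -> 'rV[R]_2) : {in [set: 'I_n]%SET, u1 =1 u2} ->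
    extended_row k0 l0 a u1 = extended_row k0 l0 a u2.
  by case: a => [a|] /= e; [exact: pinned_row_supp_all | rewrite e ?inE].
apply: (independent_functionals_dual (extended_row_lin k0 l0) supp) => c cv.
have split_sum u : \sum_a c a * extended_row k0 l0 a u =
    c None * u k0 0 l0 + \sum_a c (Some a) * row a u.
  rewrite (bigD1 None) //=; congr (_ + _).
  rewrite (reindex_omap Some id) /=; last by case.
  by apply: eq_bigl => a; rewrite eqxx.
have cN : c None = 0.
  have /eqP := cv v; rewrite split_sum big1 ?addr0 => [|a _]; last by rewrite /row rv mulr0.
  by rewrite mulf_eq0 (negPf vkl) orbF => /eqP.
case=> [a|//].
apply: (pinned_rows_full_independent hP gen ne0 (c := fun a => c (Some a))) => u.
by have := cv u; rewrite split_sum cN mul0r add0r.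
Qed.

(** In the basis dual to the extended rows, preserving the contacts and moving one
    coordinate at unit speed reads y + Q y = t u, where Q collects the squared
    relative displacements along contacts. *)
Lemma pinned_motion : exists k0 l0 (C : R) (d : R) (w : R -> 'I_n -> 'rV[R]_2),
  [/\ 0 < d, 0 <= C,
    forall k, w 0 k = 0,
    forall s t k l, `|s| <= d -> `|t| <= d -> `|w s k 0 l - w t k 0 l| <= C * `|s - t| &
    forall t, `|t| <= d -> [/\ preserves_contacts p r (w t), w t i0 = 0,
      cross (p j0 - p i0) (w t j0) = 0 & w t k0 0 l0 = t]].
Proof.
have [k0 [l0 [B BP]]] := extended_dual.
exists k0, l0.
pose I : finType := option ({e : {set 'I_n} | e \in edges (contact p r)} + option 'I_2)%type.
pose N := #|I|.
pose w (Y : 'rV[R]_N) k := \sum_(a : I) Y 0 (enum_rank a) *: B a k.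
pose q (e : {set 'I_n}) (v : 'I_n -> 'rV[R]_2) :=
  pair_sum (fun i j => dotp (v j - v i) (v j - v i) / 2) e.
pose Qa (a : I) (Y : 'rV[R]_N) :=
  match a with Some (inl e) => q (val e) (w Y) | _ => 0 end.
pose Q (Y : 'rV[R]_N) : 'rV[R]_N := \row_k Qa (enum_val k) Y.
pose u : 'rV[R]_N := \row_k (enum_val k == None)%:R.
have qE i j v : contact p r i j ->
    q [set i; j]%SET v = dotp (v j - v i) (v j - v i).
  move=> ij; rewrite /q pair_sum2 ?(contact_irr ij) //.
  by rewrite !dotpE !mxE; field.
have row_w a Y : extended_row k0 l0 a (w Y) = Y 0 (enum_rank a).
  rewrite /w (functional_sum (extended_row_lin k0 l0)) (bigD1 a) //= BP eqxx mulr1.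
  by rewrite big1 ?addr0 // => b ba; rewrite BP eq_sym (negPf ba) mulr0.
pose C := 1 + \sum_(a : I) \sum_k \sum_l `|B a k 0 l|.
have C_gt0 : 0 < C.
  rewrite ltr_pwDl // sumr_ge0 // => a _; rewrite sumr_ge0 // => k _.
  by rewrite sumr_ge0.
have C_ge0 := ltW C_gt0.
have wC Y k l : `|w Y k 0 l| <= C * `|Y|.
  rewrite /w summxE; apply: le_trans (ler_norm_sum _ _ _) _.
  apply: (@le_trans _ _ ((\sum_(a : I) \sum_k \sum_l `|B a k 0 l|) * `|Y|)).
    rewrite mulr_suml; apply: ler_sum => a _; rewrite mxE normrM mulrC.
    apply: ler_pM => //; last exact: rV_coord_le.
    rewrite (bigD1 k) //= (bigD1 l) //= -addrA lerDl addr_ge0 ?sumr_ge0 // => k' _.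
    by rewrite sumr_ge0.
  by rewrite ler_wpM2r // /C lerDr.
have wB Y Z k l : w Y k 0 l - w Z k 0 l = w (Y - Z) k 0 l.
  rewrite /w !summxE -sumrB; apply: eq_bigr => a _.
  by rewrite !mxE mulrBl.
have w0 k : w 0 k = 0.
  by rewrite /w big1 // => a _; rewrite mxE scale0r.
have [||||d d0 [y [y0 yQ ylip]]] := @perturbed_identity R _ Q (8 * C ^+ 2) u.
- by rewrite mulr_gt0 // exprn_gt0.
- apply: rV_norm_le => // k; rewrite mxE ger0_norm //.
  by case: (_ == _).
- apply/rowP => k; rewrite !mxE /Qa; case: (enum_val k) => [[e|//]|//].
  rewrite /q /pair_sum big1 // => i _; rewrite big1 // => j _.
  by rewrite !w0 subrr dotpE !mxE !mul0r addr0 mul0r if_same.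
- move=> Y Z; have bound_ge0 : 0 <= 8 * C ^+ 2 * (`|Y| + `|Z|) * `|Y - Z|.
    by rewrite !mulr_ge0 // ?exprn_ge0 // addr_ge0.
  apply: rV_norm_le => // k; rewrite !mxE /Qa.
  case: (enum_val k) => [[[e eE]|?]|]; rewrite ?subrr ?normr0 //=.
  have [i [j [ij ee]]] := edgesP eE; rewrite ee !qE // !dotpE !mxE.
  have bd l : `|(w Y j 0 l - w Y i 0 l) * (w Y j 0 l - w Y i 0 l) -
               (w Z j 0 l - w Z i 0 l) * (w Z j 0 l - w Z i 0 l)| <=
      4 * C ^+ 2 * (`|Y| + `|Z|) * `|Y - Z|.
    have -> : (w Y j 0 l - w Y i 0 l) * (w Y j 0 l - w Y i 0 l) -
               (w Z j 0 l - w Z i 0 l) * (w Z j 0 l - w Z i 0 l) =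
      ((w Y j 0 l - w Y i 0 l) + (w Z j 0 l - w Z i 0 l)) *
      (w (Y - Z) j 0 l - w (Y - Z) i 0 l) by rewrite -!wB; ring.
    rewrite normrM.
    have h1 : `|w Y j 0 l - w Y i 0 l + (w Z j 0 l - w Z i 0 l)| <=
        2 * C * (`|Y| + `|Z|).
      apply: le_trans (ler_normD _ _) _.
      have := ler_normB (w Y j 0 l) (w Y i 0 l); have := ler_normB (w Z j 0 l) (w Z i 0 l).
      have := wC Y j l; have := wC Y i l; have := wC Z j l; have := wC Z i l.
      by lra.
    have h2 : `|w (Y - Z) j 0 l - w (Y - Z) i 0 l| <= 2 * C * `|Y - Z|.
      have := ler_normB (w (Y - Z) j 0 l) (w (Y - Z) i 0 l).
      by have := wC (Y - Z) j l; have := wC (Y - Z) i l; lra.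
    apply: le_trans (ler_pM _ _ h1 h2) _ => //.
    by rewrite le_eqVlt; apply/orP; left; apply/eqP; ring.
  have -> : 8 * C ^+ 2 * (`|Y| + `|Z|) * `|Y - Z| =
     4 * C ^+ 2 * (`|Y| + `|Z|) * `|Y - Z| + 4 * C ^+ 2 * (`|Y| + `|Z|) * `|Y - Z|.
    by ring.
  rewrite opprD addrACA; apply: le_trans (ler_normD _ _) _.
  by apply: lerD; exact: bd.
exists (C * 2), d, (fun t => w (y t)); split=> //.
- by rewrite mulr_ge0.
- by move=> k; rewrite y0 w0.
- move=> s t k l hs ht; rewrite wB; apply: le_trans (wC _ _ _) _.
  by rewrite -mulrA ler_pM2l // ylip.
- move=> t td.
  have ya (a : I) : y t 0 (enum_rank a) = t * (a == None)%:R - Qa a (y t).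
    have := congr1 (fun Y : 'rV[R]_N => Y 0 (enum_rank a)) (yQ t td).
    by rewrite !mxE enum_rankK => <-; rewrite addrK.
  have wi0 : w (y t) i0 = 0.
    have coord l : w (y t) i0 0 l = 0.
      have := row_w (Some (inr (Some l))) (y t); rewrite ya /= => ->.
      by rewrite mulr0 subr0.
    by apply: row2P; rewrite coord mxE.
  split=> //.
  + move=> i j ij.
    have eE := contact_edge ij.
    have := row_w (Some (inl (Sub [set i; j]%SET eE))) (y t).
    rewrite ya /extended_row /row pinned_row_edge ?(contact_irr ij) // /dist_preserved => ->.
    by rewrite /= qE // mulr0 sub0r addNr.
  + have := row_w (Some (inr None)) (y t); rewrite ya /= wi0 subr0 => ->.
    by rewrite mulr0 subr0.
  + by have := row_w None (y t); rewrite ya /= mulr1 subr0.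
Qed.

End PinnedMotion.

(** * Flexibility with fewer contacts *)

Lemma lipschitz_within (R : realType) (V : normedModType R) (A : set R) (f : R -> V) (L : R) :
  (forall s t, A s -> A t -> `|f s - f t| <= L * `|s - t|) ->
  {within A, continuous f}.
Proof.
move=> lip; apply/subspace_continuousP => x Ax; apply/cvgrPdist_le => e e0.
have L1 : 0 < `|L| + 1 by rewrite ltr_wpDl.
rewrite near_withinE; near=> t => At.
apply: le_trans (lip _ _ Ax At) _.
have xt : `|x - t| <= e / (`|L| + 1).
  by near: t; apply: cvgr_dist_le; [exact: cvg_id | rewrite divr_gt0].
have : (`|L| + 1) * `|x - t| <= e by rewrite mulrC -ler_pdivlMr.
have := ler_norm L; have := normr_ge0 (x - t); nra.
Unshelve. all: by end_near. Qed.

Definition small (R : realType) (P : R -> Prop) :=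
  exists2 e, 0 < e & forall t, 0 <= t <= e -> P t.

Lemma small_all (R : realType) (T : finType) (P : T -> R -> Prop) :
  (forall i, small (P i)) -> small (fun t => forall i, P i t).
Proof.
move=> sP.
have [e e0 eP] : small (fun t => forall i, i \in enum T -> P i t).
  elim: (enum T) => [|i s [e e0 eP]]; first by exists 1.
  have [d d0 dP] := sP i; exists (Num.min d e); first by rewrite lt_min d0.
  move=> t /andP[t0]; rewrite le_min => /andP[td te] j.
  by rewrite inE => /orP[/eqP ->|/eP]; [apply: dP | apply]; rewrite t0.
by exists e => // t /eP h i; apply: h; rewrite mem_enum.
Qed.

Lemma small_and (R : realType) (P Q : R -> Prop) :
  small P -> small Q -> small (fun t => P t /\ Q t).
Proof.
move=> [d d0 dP] [e e0 eP]; exists (Num.min d e); first by rewrite lt_min d0.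
move=> t /andP[t0]; rewrite le_min => /andP[td te].
by split; [apply: dP | apply: eP]; rewrite t0.
Qed.

(** The bound t <= 1 allows t^2 to be estimated by t. *)
Lemma small_linear (R : realType) (A c : R) : 0 <= A -> 0 < c ->
  small (fun t => t <= 1 /\ A * t < c).
Proof.
move=> A0 c0; have A1 : 0 < A + 1 by rewrite ltr_wpDl.
exists (Num.min 1 (c / (A + 1))); first by rewrite lt_min ltr01 divr_gt0.
move=> t /andP[t0]; rewrite le_min => /andP[t1]; rewrite ler_pdivlMr // => tc.
split=> //; have [->|tN0] := eqVneq t 0; first by rewrite mulr0.
have : 0 < t by rewrite lt_def tN0.
by move: tc; rewrite mulrDr mulr1 mulrC; lra.
Qed.

Section LooseFlexible.
Variables (R : realType) (n : nat) (hn : (2 <= n)%N).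
Variables (p : 'I_n -> 'rV[R]_2) (r : 'I_n -> R).
Hypothesis hP : is_packing p r.
Hypothesis gen : generic r \/ generic (radii_ratios hn r).
Hypothesis loose : (#|edges (contact p r)| < 2 * n - 3)%N.
Variables (i0 j0 : 'I_n).
Hypothesis ne0 : i0 != j0.

Let d := p j0 - p i0.
Let D0 : 0 < dotp d d := pin_base_gt0 hP ne0.

(** A displacement that preserves all distances is an isometry; with the pins it is
    the identity or a reflection, unless it reverses the direction from [i0] to
    [j0].  The two bounds exclude the alternatives, which move some center by a
    definite amount. *)
Lemma pinned_isometric_displacement0 (w : 'I_n -> 'rV[R]_2) :
  w i0 = 0 -> cross d (w j0) = 0 -> (forall i j, dist_preserved p w i j) ->
  dotp (w j0) (w j0) < 4 * dotp d d ->
  (forall k, cross d (p k - p i0) != 0 ->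
     dotp (w k) (w k) * dotp d d < 4 * cross d (p k - p i0) ^+ 2) ->
  forall k, w k = 0.
Proof.
move=> wi wj iso smallj smallk.
have norm0 v : dotp v v = 0 -> v = 0 :> 'rV[R]_2.
  rewrite dotpE -!expr2 => /eqP; rewrite paddr_eq0 ?sqr_ge0 // !sqrf_eq0.
  by move=> /andP[/eqP e0 /eqP e1]; apply: row2P; rewrite mxE.
have lagrange (u v : 'rV[R]_2) : dotp u u * dotp v v = dotp u v ^+ 2 + cross u v ^+ 2.
  by rewrite /cross !dotpE; ring.
have wj0 : w j0 = 0.
  have := iso i0 j0; rewrite /dist_preserved /strain wi subr0 -/d => e.
  have := lagrange d (w j0); rewrite wj expr0n addr0 => e2.
  have e3 : dotp d (w j0) = - (dotp (w j0) (w j0) / 2) by lra.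
  apply: norm0; apply/eqP/negPn/negP => N0.
  have : dotp d d = dotp (w j0) (w j0) / 4.
    by apply: (mulIf N0); rewrite e2 e3; field.
  by lra.
move=> k; apply: norm0.
have := iso i0 k; have := iso j0 k; rewrite /dist_preserved /strain wi wj0 !subr0 => ej ei.
set a := p k - p i0 in ei *.
have dw : dotp d (w k) = 0.
  have -> : dotp d (w k) = dotp a (w k) - dotp (p k - p j0) (w k).
    by rewrite /d /a !dotpE !mxE; ring.
  by lra.
(* the displacement is across [d]; by [key] below it is 0 or a reflection *)
have lw := lagrange d (w k); rewrite dw expr0n add0r in lw.
have aw : dotp d d * dotp a (w k) = cross d a * cross d (w k).
  have -> : dotp d d * dotp a (w k) = dotp d a * dotp d (w k) + cross d a * cross d (w k).
    by rewrite /cross !dotpE; ring.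
  by rewrite dw mulr0 add0r.
have key : cross d (w k) * (2 * cross d a + cross d (w k)) = 0.
  have -> : cross d (w k) * (2 * cross d a + cross d (w k)) =
     2 * (cross d a * cross d (w k)) + cross d (w k) ^+ 2 by ring.
  by rewrite -aw -lw; transitivity (dotp d d * (2 * dotp a (w k) + dotp (w k) (w k)));
    [ring | rewrite ei mulr0].
apply/eqP; move/eqP: key; rewrite mulf_eq0 => /orP[/eqP cw|/eqP cw].
  by move: lw; rewrite cw expr0n => /eqP; rewrite mulf_eq0 gt_eqF.
have cE : cross d (w k) = - 2 * cross d a by lra.
have [c0|cN0] := eqVneq (cross d a) 0.
  by move: lw; rewrite cE c0 mulr0 expr0n => /eqP; rewrite mulf_eq0 gt_eqF.
have := smallk k cN0; rewrite mulrC lw cE -/a.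
by have -> : (- 2 * cross d a) ^+ 2 = 4 * cross d a ^+ 2; [ring | rewrite ltxx].
Qed.

(** The pinned motion, run slowly enough that disks that do not touch stay apart
    and that [pinned_isometric_displacement0] applies.  Its parameter is a
    coordinate, so it does move. *)
Lemma loose_flexible : flexible p r.
Proof.
move=> rig.
have [k0 [l0 [C [e [w [e0 C0 w0 wlip wP]]]]]] := pinned_motion hP gen loose ne0.
have wsmall t k l : 0 <= t <= e -> `|w t k 0 l| <= C * t.
  case/andP=> t0 te; have := @wlip t 0 k l.
  by rewrite w0 mxE !subr0 normr0 (ger0_norm t0) => /(_ te (ltW e0)).
have wsq t k : 0 <= t <= e -> dotp (w t k) (w t k) <= 2 * C ^+ 2 * t ^+ 2.
  move=> te; have sq l : w t k 0 l ^+ 2 <= (C * t) ^+ 2.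
    rewrite -real_normK ?num_real // lerXn2r ?nnegrE ?wsmall //.
    by rewrite mulr_ge0 //; case/andP: te.
  have := sq 0; have := sq 1; rewrite dotpE -!expr2 exprMn; lra.
have small_e : small (fun t : R => t <= e) by exists e => // t /andP[].
have small_sep : small (fun t => forall i j, i != j ->
    (r i + r j) ^+ 2 <= dotp (p i + w t i - (p j + w t j)) (p i + w t i - (p j + w t j))).
  apply: small_all => i; apply: small_all => j.
  case: (boolP (contact p r i j)) => [ij|nij].
    exists e => // t te _; have td : `|t| <= e by rewrite ger0_norm; case/andP: te.
    have [keep _ _ _] := wP t td; have := keep i j ij.
    move: ij; rewrite contactE // => /andP[_ /eqP <-].
    by rewrite /dist_preserved /strain !dotpE !mxE; lra.
  have [->|ij] := eqVneq i j; first by exists 1.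
  have gap : 0 < dotp (p i - p j) (p i - p j) - (r i + r j) ^+ 2.
    rewrite subr_gt0 lt_def; case/packing_separated: hP => _ -> //.
    by move: nij; rewrite contactE // ij /= andbT.
  set x0 := p i 0 0 - p j 0 0; set x1 := p i 0 1 - p j 0 1.
  have A0 : 0 <= 4 * C * (`|x0| + `|x1|) by rewrite !mulr_ge0 // addr_ge0.
  have [c c0 cP] := small_and small_e (small_linear A0 gap).
  exists c => // t tc _; have [te [_]] := cP t tc.
  have t0e : 0 <= t <= e by case/andP: tc => ->.
  have ybound l : `|w t i 0 l - w t j 0 l| <= 2 * (C * t).
    apply: le_trans (ler_normB _ _) _.
    by have := wsmall t i l t0e; have := wsmall t j l t0e; lra.
  have prod (x y b : R) : `|y| <= b -> - (`|x| * b) <= x * y.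
    move=> yb; have : `|x * y| <= `|x| * b by rewrite normrM ler_wpM2l.
    by rewrite ler_norml => /andP[].
  have := prod x0 _ _ (ybound 0); have := prod x1 _ _ (ybound 1).
  rewrite !dotpE !mxE -/x0 -/x1.
  set y0 := w t i 0 0 - w t j 0 0; set y1 := w t i 0 1 - w t j 0 1.
  have -> : p i 0 0 + w t i 0 0 - (p j 0 0 + w t j 0 0) = x0 + y0 by rewrite /x0 /y0; ring.
  have -> : p i 0 1 + w t i 0 1 - (p j 0 1 + w t j 0 1) = x1 + y1 by rewrite /x1 /y1; ring.
  have := sqr_ge0 y0; have := sqr_ge0 y1; rewrite !expr2; clear; lra.
have small_j : small (fun t => dotp (w t j0) (w t j0) < 4 * dotp d d).
  have A0 : 0 <= 2 * C ^+ 2 by rewrite mulr_ge0 // exprn_ge0.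
  have dd0 : 0 < 4 * dotp d d by rewrite mulr_gt0.
  have [c c0 cP] := small_and small_e (small_linear A0 dd0).
  exists c => // t tc; have [te [t1 lt]] := cP t tc; case/andP: tc => t0 _.
  apply: le_lt_trans (wsq _ _ _) (le_lt_trans _ lt); first by rewrite t0.
  by rewrite ler_wpM2l // expr2 ler_piMr.
have small_k : small (fun t => forall k, cross d (p k - p i0) != 0 ->
     dotp (w t k) (w t k) * dotp d d < 4 * cross d (p k - p i0) ^+ 2).
  apply: small_all => k; have [->|cN0] := eqVneq (cross d (p k - p i0)) 0.
    by exists 1 => // t _; rewrite eqxx.
  have A0 : 0 <= 2 * C ^+ 2 * dotp d d by rewrite !mulr_ge0 ?exprn_ge0 // ltW.
  have cc0 : 0 < 4 * cross d (p k - p i0) ^+ 2 by rewrite mulr_gt0 // exprn_even_gt0.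
  have [c c0 cP] := small_and small_e (small_linear A0 cc0).
  exists c => // t tc _; have [te [t1 lt]] := cP t tc; case/andP: tc => t0 _.
  apply: le_lt_trans lt; rewrite mulrAC ler_pM2r //.
  apply: le_trans (wsq _ _ _) _; first by rewrite t0.
  by rewrite ler_wpM2l ?mulr_ge0 ?exprn_ge0 // expr2 ler_piMr.
have [c c0 cP] := small_and small_e (small_and small_sep (small_and small_j small_k)).
pose q (t : R) k := p k + w (c * t) k.
have scale t : t \in `[0, 1] -> 0 <= c * t <= c.
  by rewrite in_itv /= => /andP[t0 t1]; rewrite mulr_ge0 ?ler_piMr // ltW.
have ct_e t : t \in `[0, 1] -> `|c * t| <= e.
  move=> /scale ct; have [le _] := cP _ ct.
  by rewrite ger0_norm //; case/andP: ct.
have flex_q : is_flex p r q.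
  split.
  - move=> i; apply: (@lipschitz_within _ _ _ _ (C * c)) => s t s01 t01.
    apply: rV_norm_le => [|l]; first by rewrite !mulr_ge0 // ltW.
    rewrite /q !mxE opprD addrACA subrr add0r.
    apply: le_trans (wlip _ _ _ _ (ct_e s s01) (ct_e t t01)) _.
    by rewrite -mulrBr normrM (gtr0_norm c0) mulrA.
  - by move=> i; rewrite /q mulr0 w0 addr0.
  - move=> t t01; have [_ [sep _]] := cP _ (scale t t01).
    have pq : is_packing (q t) r.
      by apply/packing_separated; split; [exact: packing_r_gt0 hP | exact: sep].
    split=> // i j ij; have [keep _ _ _] := wP _ (ct_e t t01).
    have := keep i j ij; move: (ij); rewrite !contactE // => /andP[-> /eqP <-] /= e1.
    by apply/eqP; move: e1; rewrite /dist_preserved /q /strain !dotpE !mxE; lra.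
have [g [giso _ _] gq] := rig q flex_q.
have one : (1 : R) \in `[0, 1] by rewrite in_itv /= lexx ler01.
have [_ [_ [sj sk]]] := cP _ (scale 1 one).
have [_ wi wj wk] := wP _ (ct_e 1 one).
have iso i j : dist_preserved p (w (c * 1)) i j.
  have := (is_isometryP (g 1)).1 (giso 1 one) (p i) (p j).
  by rewrite -!gq // /q /dist_preserved /strain !dotpE !mxE; lra.
have := pinned_isometric_displacement0 wi wj iso sj sk k0 => wk0.
by move: wk; rewrite wk0 mxE mulr1 => /esym/eqP; rewrite gt_eqF.
Qed.

End LooseFlexible.

Theorem theorem1p5 (R : realType) (n : nat) (hn : (2 <= n)%N)
  (p : 'I_n -> 'rV[R]_2) (r : 'I_n -> R) (hP : is_packing p r)
  (hgen : generic r \/ generic (radii_ratios hn r)) :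
  [/\ (#|edges (contact p r)| <= 2 * n - 3)%N,
      laman_sparse (contact p r),
      planar R (contact p r),
      (#|edges (contact p r)| = 2 * n - 3)%N -> rigid p r /\ inf_rigid p r &
      (#|edges (contact p r)| < 2 * n - 3)%N ->
        flexible p r /\ inf_flexible p r].
Proof.
have [i [j [_ _ ij]]] : exists i j : 'I_n, [/\ i \in predT, j \in predT & i != j].
  by apply/card_gt1P; rewrite card_ord.
split.
- exact: contact_edges_leq hP hgen.
- exact: contact_laman_sparse hP hgen.
- exact: contact_planar hP.
- move=> tight; split; last exact (tight_inf_rigid hP hgen ij tight).
  have : (0 < #|edges (contact p r)|)%N by rewrite tight subn_gt0; have := hn; lia.
  case/card_gt0P=> e /edgesP[i1 [j1 [ij1 _]]].
  exact (tight_rigid hP hgen tight ij1).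
- move=> loose; split; first exact (loose_flexible hP hgen loose ij).
  exact (loose_inf_flexible hP ij loose).
Qed.
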